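(* Let $N_0$ be a positive integer and let $\{M_N\}_{N\geq N_0}$ be positive integers with $\lim_{N\to\infty}M_N=\infty$. For each $N\geq N_0$, let $\mathbf{r}^{(N)}\in\mathbb{R}^{M_N}$ and $\mathbf{c}^{(N)}\in\mathbb{R}^N$ be positive vectors with $\Vert\mathbf{r}^{(N)}\Vert_1=\Vert\mathbf{c}^{(N)}\Vert_1=:s^{(N)}$, let $\widetilde{A}^{(N)}\in\mathbb{R}^{M_N\times N}$ be a positive random matrix, let $A^{(N)}=\mathbb{E}[\widetilde{A}^{(N)}]$, and let $(\mathbf{x}^{(N)},\mathbf{y}^{(N)})$ be the unique pair of positive vectors with $\Vert\mathbf{x}^{(N)}\Vert_1=\Vert\mathbf{y}^{(N)}\Vert_1$ that scales $A^{(N)}$ to row sums $\mathbf{r}^{(N)}$ and column sums $\mathbf{c}^{(N)}$. Suppose that there are constants $0<a\leq b$, independent of $N$, such that for every $N\geq N_0$: $\widetilde{A}^{(N)}_{i,j}\in[a,b]$ almost surely for all $i\in[M_N]$, $j\in[N]$; the variables $\{\widetilde{A}^{(N)}_{i,j}\}_{j=1}^N$ are independent for each $i\in[M_N]$; and the variables $\{\widetilde{A}^{(N)}_{i,j}\}_{i=1}^{M_N}$ are independent for each $j\in[N]$. Then there exists a sequence $\{(\widetilde{\mathbf{x}}^{(N)},\widetilde{\mathbf{y}}^{(N)})\}_{N\ge N_0}$ of pairs of positive random vectors, where $(\widetilde{\mathbf{x}}^{(N)},\widetilde{\mathbf{y}}^{(N)})$ scales $\widetilde{A}^{(N)}$ to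 row sums $\mathbf{r}^{(N)}$ and column sums $\mathbf{c}^{(N)}$, such that $$\mathcal{E}_N(\widetilde{\mathbf{x}}^{(N)},\widetilde{\mathbf{y}}^{(N)})=\mathcal{O}_{\text{w.h.p}}\left(\rho_1^{(N)}\rho_2^{(N)}\sqrt{\log(\max\{M_N,N\})}\right).$$
   Context: $[n]=\{1,\ldots,n\}$. A matrix or vector is positive if all its entries are strictly positive. A pair of vectors $(\mathbf{x},\mathbf{y})$ scales a matrix $B\in\mathbb{R}^{M\times N}$ to row sums $\mathbf{r}$ and column sums $\mathbf{c}$ if $\sum_{j=1}^N x_iB_{i,j}y_j=r_i$ for all $i\in[M]$ and $\sum_{i=1}^M x_iB_{i,j}y_j=c_j$ for all $j\in[N]$. For positive $B,\mathbf{r},\mathbf{c}$ with $\Vert\mathbf{r}\Vert_1=\Vert\mathbf{c}\Vert_1$ there is exactly one positive pair $(\mathbf{x},\mathbf{y})$ with $\Vert\mathbf{x}\Vert_1=\Vert\mathbf{y}\Vert_1$ scaling $B$ to row sums $\mathbf{r}$ and column sums $\mathbf{c}$. Error measure: for $\widetilde{\mathbf{x}}\in\mathbb{R}^{M_N}$, $\widetilde{\mathbf{y}}\in\mathbb{R}^N$, $$\mathcal{E}_N(\widetilde{\mathbf{x}},\widetilde{\mathbf{y}})=\max\left\{\max_{i\in[M_N]}\frac{\vert\widetilde{x}_i-x_i^{(N)}\vert}{x_i^{(N)}},\ \max_{j\in[N]}\frac{\vert\widetilde{y}_j-y_j^{(N)}\vert}{y_j^{(N)}}\right\}.$$ Further,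 $$\rho_1^{(N)}=\max\left\{\frac{\Vert\mathbf{r}^{(N)}\Vert_2}{s^{(N)}},\frac{\Vert\mathbf{c}^{(N)}\Vert_2}{s^{(N)}}\right\},\qquad\rho_2^{(N)}=\max\left\{\frac{s^{(N)}}{M_N\min_i r_i^{(N)}},\frac{s^{(N)}}{N\min_j c_j^{(N)}}\right\}.$$ For a sequence of random variables $X_N$ and a deterministic sequence $\gamma_N$, $X_N=\mathcal{O}_{\text{w.h.p}}(\gamma_N)$ means that there exists a constant $C$ (independent of $N$) with $\lim_{N\to\infty}\Pr\{X_N\leq C\gamma_N\}=1$. *)

(* Defs.v *)
From HB Require Import structures.
From mathcomp Require Import all_boot all_order all_algebra.
From mathcomp Require Import all_classical all_reals all_analysis.
From mathcomp Require Import measurable_realfun.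

Set Implicit Arguments.
Unset Strict Implicit.
Unset Printing Implicit Defensive.

Import Order.TTheory GRing.Theory Num.Theory.
Import numFieldNormedType.Exports.

Local Open Scope classical_set_scope.
Local Open Scope ring_scope.

Section Vectors.
Context {R : realType}.

Definition positive_mx {m n : nat} (B : 'M[R]_(m, n)) : Prop :=
  forall i j, 0 < B i j.

(* [`|v|] on matrices is the sup norm, hence these two definitions. *)
Definition norm1 {n : nat} (v : 'rV[R]_n) : R := \sum_i `|v 0 i|.
Definition norm2 {n : nat} (v : 'rV[R]_n) : R := Num.sqrt (\sum_i v 0 i ^+ 2).

(* The minimum of the entries when 0 < n; it is 0 for n = 0. *)
Definition min_entry {n : nat} (v : 'rV[R]_n) : R := inf (range (v 0)).

Definition scales {m n : nat} (x : 'rV[R]_m) (y : 'rV[R]_n)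
    (B : 'M[R]_(m, n)) (r : 'rV[R]_m) (c : 'rV[R]_n) : Prop :=
  (forall i, \sum_j x 0 i * B i j * y 0 j = r 0 i) /\
  (forall j, \sum_i x 0 i * B i j * y 0 j = c 0 j).

(* For positive x the terms are nonnegative, so the default value 0 of the
   iterated maximum does not affect it. *)
Definition max_rel_dev {n : nat} (xt x : 'rV[R]_n) : R :=
  \big[Num.max/0]_i (`|xt 0 i - x 0 i| / x 0 i).

Definition scaling_error {m n : nat} (xt : 'rV[R]_m) (yt : 'rV[R]_n)
    (x : 'rV[R]_m) (y : 'rV[R]_n) : R :=
  Num.max (max_rel_dev xt x) (max_rel_dev yt y).

(* The common value s of norm1 r and norm1 c is taken to be norm1 r. *)
Definition rho1 {m n : nat} (r : 'rV[R]_m) (c : 'rV[R]_n) : R :=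
  Num.max (norm2 r / norm1 r) (norm2 c / norm1 r).

Definition rho2 {m n : nat} (r : 'rV[R]_m) (c : 'rV[R]_n) : R :=
  Num.max (norm1 r / (m%:R * min_entry r)) (norm1 r / (n%:R * min_entry c)).

End Vectors.

Section RandomVectors.
Context {R : realType} {d : measure_display} {T : measurableType d}.
Variable P : probability T R.

(* The product rule for subfamilies is the case E i = setT outside them. *)
Definition mutually_independent {I : finType} (X : I -> {RV P >-> R}) : Prop :=
  forall E : I -> set R, (forall i, measurable (E i)) ->
    P (\bigcap_(i in [set: I]) (X i @^-1` E i)) =
    (\prod_(i : I) P (X i @^-1` E i))%E.

Definition mx_of {m n : nat} (X : 'I_m -> 'I_n -> {RV P >-> R}) (w : T) :
  'M[R]_(m, n) := \matrix_(i, j) X i j w.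

Definition rv_of {n : nat} (X : 'I_n -> {RV P >-> R}) (w : T) : 'rV[R]_n :=
  \row_i X i w.

(* `fine` is harmless: the entries used are almost surely bounded, so their
   expectations are finite. *)
Definition expectation_mx {m n : nat} (X : 'I_m -> 'I_n -> {RV P >-> R}) :
  'M[R]_(m, n) := \matrix_(i, j) fine ('E_P[X i j])%E.

Definition random_error {m n : nat} (xt : 'I_m -> {RV P >-> R})
    (yt : 'I_n -> {RV P >-> R}) (x : 'rV[R]_m) (y : 'rV[R]_n) (w : T) : R :=
  scaling_error (rv_of xt w) (rv_of yt w) x y.

Lemma measurable_max_rel_dev {n : nat} (xt : 'I_n -> {RV P >-> R})
    (x : 'rV[R]_n) :
  measurable_fun [set: T] (fun w => max_rel_dev (rv_of xt w) x).
Proof.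
rewrite /max_rel_dev; elim: (index_enum _) => [|i s IH].
  by under eq_fun do rewrite big_nil; exact: measurable_cst.
under eq_fun do rewrite big_cons mxE.
apply: measurable_maxr => //.
apply: measurable_funM; last exact: measurable_cst.
apply: measurableT_comp; first exact: normr_measurable.
by apply: measurable_funB; [exact: measurable_funP | exact: measurable_cst].
Qed.

Lemma measurable_random_error {m n : nat} (xt : 'I_m -> {RV P >-> R})
    (yt : 'I_n -> {RV P >-> R}) (x : 'rV[R]_m) (y : 'rV[R]_n) :
  measurable_fun [set: T] (random_error xt yt x y).
Proof. by apply: measurable_maxr; exact: measurable_max_rel_dev. Qed.

HB.instance Definition _ {m n : nat} (xt : 'I_m -> {RV P >-> R})
    (yt : 'I_n -> {RV P >-> R}) (x : 'rV[R]_m) (y : 'rV[R]_n) :=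
  isMeasurableFun.Build _ _ _ _ (random_error xt yt x y)
    (measurable_random_error xt yt x y).

End RandomVectors.

Arguments mutually_independent {R d T} P {I} X.

(* X_N = O_whp(gamma_N); the X_N may live on different probability spaces. *)
Definition bigO_whp {R : realType} {d : nat -> measure_display}
    {T : forall N, measurableType (d N)} (P : forall N, probability (T N) R)
    (X : forall N, {RV (P N) >-> R}) (gamma : nat -> R) : Prop :=
  exists C : R,
    (fun N => P N [set w | X N w <= C * gamma N]) @ \oo --> (1%E : \bar R).

Arguments bigO_whp {R d T} P X gamma.

(* Main.v *)
(* Let delta = a / b. Against a positive weight z, any two rows of a matrix with
   entries in [a, b] give averaging measures that both dominate delta times
   the normalized z (Doeblin's condition). Hence one half-step
   u |-> c / (A^T u) of Sinkhorn's iteration multiplies t - 1 by at most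
   1 - delta, where t is the maximal ratio of the quotients u_i / u'_i.

   Consequently the iterates, normalized at one coordinate, converge
   geometrically, and their limit is a scaling which depends measurably on the
   matrix. If moreover (x, y) scales At up to relative errors eps in the row and
   column sums, the same contraction applied to the exact scaling (xt, yt)
   gives T <= (1 + (1 - delta) (T - 1)) (1 + 2 eps b / a) for the maximal ratio
   T of xt / x and yt / y. Since T <= (b / a)^2 a priori, T - 1 = O(eps),
   whatever the size of eps.

   The relative row and column errors are weighted sums of independent bounded
   centered variables with weights x_i y_j / r_i <= (b / a^2) c_j / s (and
   symmetrically), so Hoeffding's inequality and a union bound over at most
   2 k sums, k = max(M, N), allow eps = 4 (b / a)^2 rho1 sqrt(ln k) outside an
   event of probability at most 4 / k. Finally rho2 >= 1. *)

Require Import Defs.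
From HB Require Import structures.
From mathcomp Require Import all_boot all_order all_algebra.
From mathcomp Require Import all_classical all_reals all_analysis.
From mathcomp Require Import measurable_realfun.
From mathcomp Require Import ring lra zify.

Set Implicit Arguments.
Unset Strict Implicit.
Unset Printing Implicit Defensive.

Import Order.TTheory GRing.Theory Num.Theory.
Import numFieldNormedType.Exports.

Local Open Scope classical_set_scope.
Local Open Scope ring_scope.

(** * Contraction of Sinkhorn half-steps *)

Section Contraction.
Context {R : realType}.

Lemma finfun_min_attained {I : finType} (i0 : I) (f : I -> R) :
  exists i, forall k, f i <= f k.
Proof.
case: (@arg_minP _ _ _ i0 xpredT f) => // i _ h.
by exists i => k; exact: h.
Qed.

Lemma finfun_max_attained {I : finType} (i0 : I) (f : I -> R) :
  exists i, forall k, f k <= f i.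
Proof.
case: (@arg_maxP _ _ _ i0 xpredT f) => // i _ h.
by exists i => k; exact: h.
Qed.

(** Doeblin's argument: [p] and [p'] share the part [delta * q], which contributes the same amount
    to both averages. Only the remaining mass 1 - delta can feel the oscillation of [t], which
    ranges between its minimum m and tau m. *)
Lemma average_ratio_le {I : finType} (i0 : I) (p p' q t : I -> R) (delta tau : R) :
  \sum_i p i = 1 -> \sum_i p' i = 1 -> \sum_i q i = 1 ->
  (forall i, 0 <= q i) -> 0 <= delta <= 1 ->
  (forall i, delta * q i <= p i) -> (forall i, delta * q i <= p' i) ->
  (forall i, 0 < t i) -> (forall i k, t i <= tau * t k) ->
  \sum_i p i * t i <= (1 + (1 - delta) * (tau - 1)) * \sum_i p' i * t i.
Proof.
move=> p1 p'1 q1 q0 /andP[d0 d1] qp qp' t0 tt.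
have [k tk] := finfun_min_attained i0 t.
set m := t k in tk *.
have m0 : 0 < m by exact: t0.
have tau1 : 1 <= tau by have := tt k k; rewrite -/m => h; nra.
pose W := \sum_i q i * (t i - m).
(* Any average splits into the minimum, the shared part and a residual that depends on the weights.
   Subtracting m first makes the last two terms nonnegative for [p] and [p']. *)
have avg (w : I -> R) : \sum_i w i = 1 ->
    \sum_i w i * t i = m + delta * W + \sum_i (w i - delta * q i) * (t i - m).
  move=> w1; have -> : \sum_i w i * t i = \sum_i w i * (t i - m) + m.
    under [X in _ = X + _]eq_bigr do rewrite mulrBr.
    by rewrite sumrB -mulr_suml w1 mul1r subrK.
  rewrite [LHS]addrC -addrA; congr (_ + _); rewrite /W mulr_sumr -big_split /=.
  by apply: eq_bigr => i _; ring.
have W0 : 0 <= W by apply: sumr_ge0 => i _; rewrite mulr_ge0// subr_ge0.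
have up : \sum_i (p i - delta * q i) * (t i - m) <= (1 - delta) * ((tau - 1) * m).
  have -> : 1 - delta = \sum_i (p i - delta * q i).
    by rewrite sumrB -mulr_sumr p1 q1 mulr1.
  rewrite mulr_suml; apply: ler_sum => i _; rewrite ler_wpM2l ?subr_ge0//.
  by have := tt i k; rewrite -/m => h; lra.
have lo : 0 <= \sum_i (p' i - delta * q i) * (t i - m).
  by apply: sumr_ge0 => i _; rewrite mulr_ge0// subr_ge0.
rewrite (avg p)// (avg p')//.
have g1 : 0 <= (1 - delta) * (tau - 1) by rewrite mulr_ge0 ?subr_ge0.
have dW : 0 <= delta * W by rewrite mulr_ge0.
move: up lo g1 dW.
set A := \sum_i _; set B := \sum_i _; set g := (1 - delta) * (tau - 1).
rewrite mulrA -/g; set D := delta * W => up lo g1 dW.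
(* The goal is now m + D + A <= (1 + g) (m + D + B), with A <= g m and B >= 0. *)
have : 0 <= g * D by rewrite mulr_ge0.
have : 0 <= g * B by rewrite mulr_ge0.
nra.
Qed.

(* The least such [t] is the exponential of the Hilbert projective distance. *)
Definition ratio_le {I : finType} (t : R) (u u' : I -> R) :=
  forall i k, u i * u' k <= t * (u k * u' i).

(** Rows and columns are updated by the same function, applied to [A] or to its transpose; this is
    why vectors and matrices are plain functions on finite types here. *)
Definition half_step {I J : finType} (A : I -> J -> R) (c : J -> R)
  (u : I -> R) : J -> R := fun j => c j / \sum_i A i j * u i.

Lemma sum_gt0 {I : finType} (i0 : I) (f : I -> R) :
  (forall i, 0 < f i) -> 0 < \sum_i f i.
Proof.
move=> f0; rewrite (bigD1 i0)//= ltr_pwDl//.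
by apply: sumr_ge0 => i _; exact: ltW.
Qed.

Lemma half_step_gt0 {I J : finType} (i0 : I) (A : I -> J -> R) c u :
  (forall i j, 0 < A i j) -> (forall j, 0 < c j) -> (forall i, 0 < u i) ->
  forall j, 0 < half_step A c u j.
Proof.
move=> A0 c0 u0 j; rewrite /half_step divr_gt0//; apply: sum_gt0 => // i.
by rewrite mulr_gt0.
Qed.

(** The quotient of the column sums at l for [u] and [u'] is an average of u_i / u'_i with weights
    proportional to A_il u'_i. These weights dominate a / b times the normalized [u'] for every l,
    so two such averages can be compared. Inverting the sums exchanges j and l, and [c] cancels. *)
Lemma half_step_contract {I J : finType} (i0 : I) (A : I -> J -> R) c
    (u u' : I -> R) (a b t : R) :
  0 < a -> (forall i j, a <= A i j <= b) ->
  (forall j, 0 < c j) -> (forall i, 0 < u i) -> (forall i, 0 < u' i) ->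
  ratio_le t u u' ->
  ratio_le (1 + (1 - a / b) * (t - 1)) (half_step A c u) (half_step A c u').
Proof.
move=> a0 Aab c0 u0 u'0 uu' j l.
have A0 i k : 0 < A i k by apply: lt_le_trans a0 _; case/andP: (Aab i k).
have b0 : 0 < b by apply: lt_le_trans (A0 i0 j) _; case/andP: (Aab i0 j).
have ab : a <= b by case/andP: (Aab i0 j) => h1; exact: le_trans.
have S'0 k : 0 < \sum_i A i k * u' i by apply: sum_gt0 => // i; exact: mulr_gt0.
have S0 k : 0 < \sum_i A i k * u i by apply: sum_gt0 => // i; exact: mulr_gt0.
have U0 : 0 < \sum_i u' i by exact: sum_gt0.
have doeblin k i : a / b * (u' i / \sum_i u' i) <= A i k * u' i / \sum_i A i k * u' i.
  have h : \sum_i A i k * u' i <= b * \sum_i u' i.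
    rewrite mulr_sumr; apply: ler_sum => h _; rewrite ler_wpM2r ?(ltW (u'0 _))//.
    by case/andP: (Aab h k).
  have h2 : a * u' i <= A i k * u' i.
    by rewrite ler_wpM2r ?(ltW (u'0 _))//; case/andP: (Aab i k).
  rewrite mulrACA -invfM; apply: ler_pM => //.
  - by rewrite mulr_ge0// ltW.
  - by rewrite invr_ge0 mulr_ge0// ltW.
  - by rewrite lef_pV2 ?posrE // mulr_gt0.
have avg := @average_ratio_le I i0 (fun i => A i l * u' i / \sum_i A i l * u' i)
   (fun i => A i j * u' i / \sum_i A i j * u' i) (fun i => u' i / \sum_i u' i)
   (fun i => u i / u' i) (a / b) t.
have avgE k : \sum_i (A i k * u' i / \sum_i A i k * u' i) * (u i / u' i) =
    (\sum_i A i k * u i) / \sum_i A i k * u' i.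
  rewrite mulr_suml; apply: eq_bigr => i _.
  by field; rewrite !gt_eqF.
have {}avg : (\sum_i A i l * u i) / (\sum_i A i l * u' i) <=
    (1 + (1 - a / b) * (t - 1)) * ((\sum_i A i j * u i) / (\sum_i A i j * u' i)).
  rewrite -!avgE; apply: avg => //.
  - by rewrite -mulr_suml divff// gt_eqF.
  - by rewrite -mulr_suml divff// gt_eqF.
  - by rewrite -mulr_suml divff// gt_eqF.
  - by move=> i; rewrite divr_ge0// ltW.
  - by rewrite divr_ge0 ?(ltW a0) ?(ltW b0)//= ler_pdivrMr// mul1r.
  - by move=> i; rewrite divr_gt0.
  - move=> i k; rewrite ler_pdivrMr// mulrA mulrAC ler_pdivlMr// -mulrA.
    exact: uu'.
rewrite /half_step.
move: avg; set g := 1 + _ * _.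
set s1 := \sum_i _; set s2 := \sum_i _; set s3 := \sum_i _; set s4 := \sum_i _.
have s10 : 0 < s1 by exact: S0.
have s20 : 0 < s2 by exact: S'0.
have s30 : 0 < s3 by exact: S0.
have s40 : 0 < s4 by exact: S'0.
move=> h.
have -> : c j / s3 * (c l / s2) = (c j * c l) / (s3 * s1) * (s1 / s2).
  by field; rewrite !gt_eqF.
have -> : g * (c l / s1 * (c j / s4)) = (c j * c l) / (s3 * s1) * (g * (s3 / s4)).
  by field; rewrite !gt_eqF.
by rewrite ler_wpM2l// divr_ge0// ltW// mulr_gt0.
Qed.

End Contraction.

(** * Stability of scalings *)

Section Stability.
Context {R : realType}.

(** Multiplicative form of the triangle inequality for the Hilbert projective distance. *)
Lemma ratio_le_trans {I : finType} (t s : R) (u v w : I -> R) : 0 <= t ->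
  (forall i, 0 < u i) -> (forall i, 0 < v i) -> (forall i, 0 < w i) ->
  ratio_le t u v -> ratio_le s v w -> ratio_le (t * s) u w.
Proof.
move=> t0 u0 v0 w0 uv vw i k.
have vv : 0 < v i * v k by rewrite mulr_gt0.
rewrite -(ler_pM2r vv).
have -> : u i * w k * (v i * v k) = (u i * v k) * (v i * w k) by ring.
have -> : t * s * (u k * w i) * (v i * v k) =
  (t * (u k * v i)) * (s * (v k * w i)) by ring.
by apply: ler_pM => //; rewrite mulr_ge0// ltW.
Qed.

(** Finiteness of [I] makes the least admissible constant a value of the quotient, so that every
    other admissible constant can be compared with it. *)
Lemma ratio_max_attained {I : finType} (i0 : I) (u v : I -> R) :
  (forall i, 0 < u i) -> (forall i, 0 < v i) ->
  exists i k, ratio_le ((u i * v k) / (u k * v i)) u v.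
Proof.
move=> u0 v0.
pose F (p : I * I) := (u p.1 * v p.2) / (u p.2 * v p.1).
have [[i k] h] := finfun_max_attained (i0, i0) F.
exists i, k => i' k'; rewrite -ler_pdivrMr ?mulr_gt0//.
exact: (h (i', k')).
Qed.

Lemma weighted_sum_bounds {J : finType} (A : J -> R) (a b : R) (y : J -> R) :
  (forall j, a <= A j <= b) -> (forall j, 0 < y j) ->
  a * \sum_j y j <= \sum_j A j * y j <= b * \sum_j y j.
Proof.
move=> Aab y0; rewrite !mulr_sumr; apply/andP; split; apply: ler_sum => j _;
  by rewrite ler_wpM2r ?(ltW (y0 _))//; case/andP: (Aab j).
Qed.

(** Each factor is r_i divided by a weighted row sum, and [r] cancels in the ratio. The row sums of
    one matrix against one weight differ by a factor of at most b / a, and two matrices are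
    involved. *)
Lemma scaled_ratio_apriori {I J : finType} (j0 : J) (At A : I -> J -> R)
    (r xt x : I -> R) (yt y : J -> R) (a b : R) :
  0 < a -> (forall i j, a <= At i j <= b) -> (forall i j, a <= A i j <= b) ->
  (forall i, 0 < r i) -> (forall j, 0 < yt j) -> (forall j, 0 < y j) ->
  (forall i, xt i * \sum_j At i j * yt j = r i) ->
  (forall i, x i * \sum_j A i j * y j = r i) ->
  ratio_le ((b / a) ^+ 2) xt x.
Proof.
move=> a0 Atab Aab r0 yt0 y0 xtE xE i k.
have Y0 : 0 < \sum_j y j by exact: sum_gt0.
have Yt0 : 0 < \sum_j yt j by exact: sum_gt0.
have bt l := weighted_sum_bounds (Atab l) yt0.
have bd l := weighted_sum_bounds (Aab l) y0.
have St0 l : 0 < \sum_j At l j * yt j.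
  by case/andP: (bt l) => h _; apply: lt_le_trans h; exact: mulr_gt0.
have S0 l : 0 < \sum_j A l j * y j.
  by case/andP: (bd l) => h _; apply: lt_le_trans h; exact: mulr_gt0.
have xtq l : xt l = r l / \sum_j At l j * yt j.
  by rewrite -xtE mulfK// gt_eqF.
have xq l : x l = r l / \sum_j A l j * y j.
  by rewrite -xE mulfK// gt_eqF.
rewrite !xtq !xq.
case/andP: (bt i) (bt k) (bd i) (bd k) => h1 h2 /andP[h3 h4] /andP[h5 h6] /andP[h7 h8].
move: h1 h2 h3 h4 h5 h6 h7 h8 (St0 i) (St0 k) (S0 i) (S0 k).
set s := \sum_j At i j * _; set s' := \sum_j At k j * _.
set q := \sum_j A i j * _; set q' := \sum_j A k j * _.
move=> h1 h2 h3 h4 h5 h6 h7 h8 s0 s'0 q0 q'0.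
have b0 : 0 < b.
  by apply: (lt_le_trans a0); case/andP: (Atab i j0) => u v; exact: le_trans u v.
have k1 : s' <= b / a * s.
  apply: (le_trans h4); rewrite mulrAC ler_pdivlMr// -mulrA ler_wpM2l ?(ltW b0)//.
  by rewrite mulrC.
have k2 : q <= b / a * q'.
  apply: (le_trans h6); rewrite mulrAC ler_pdivlMr// -mulrA ler_wpM2l ?(ltW b0)//.
  by rewrite mulrC.
have -> : r i / s * (r k / q') = (r i * r k) / (s * s' * q * q') * (s' * q).
  by field; rewrite !gt_eqF.
have -> : (b / a) ^+ 2 * (r k / s' * (r i / q)) =
    (r i * r k) / (s * s' * q * q') * ((b / a * s) * (b / a * q')).
  by field; rewrite !gt_eqF.
apply: ler_wpM2l; first by rewrite divr_ge0// ?mulr_ge0// ltW.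
by apply: ler_pM => //; exact: ltW.
Qed.

(** The exact factor [xt] is a half-step from [yt]. It is compared with the half-step from [y] by
    contraction, and that one with [x] through the relative row errors. The lower bound a / b on the
    approximate row sums makes this work for every eps, including eps >= 1. *)
Lemma scaled_ratio_step {I J : finType} (j0 : J) (At : I -> J -> R)
    (r xt x : I -> R) (yt y : J -> R) (a b eps T : R) :
  0 < a -> a <= b -> 0 <= eps -> 1 <= T -> (forall i j, a <= At i j <= b) ->
  (forall i, 0 < r i) -> (forall i, 0 < x i) ->
  (forall j, 0 < yt j) -> (forall j, 0 < y j) ->
  (forall i, xt i * \sum_j At i j * yt j = r i) ->
  (forall i, `|x i * \sum_j At i j * y j - r i| <= eps * r i) ->
  (forall i, a / b * r i <= x i * \sum_j At i j * y j) ->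
  ratio_le T yt y ->
  ratio_le ((1 + (1 - a / b) * (T - 1)) * (1 + 2 * eps * (b / a))) xt x.
Proof.
move=> a0 ab e0 T1 Atab r0 x0 yt0 y0 xtE xe xlo yy.
have b0 : 0 < b by exact: lt_le_trans ab.
have At0 i j : 0 < At i j by case/andP: (Atab i j) => h _; exact: lt_le_trans h.
pose B j i := At i j.
have B0 j i : 0 < B j i by exact: At0.
have S0 l : 0 < \sum_j B j l * yt j by apply: sum_gt0 => // j; exact: mulr_gt0.
have S'0 l : 0 < \sum_j B j l * y j by apply: sum_gt0 => // j; exact: mulr_gt0.
have xtq : half_step B r yt = xt.
  apply/funext => i; rewrite /half_step -xtE mulfK//.
  by rewrite gt_eqF//; exact: S0.
have xt0 i : 0 < xt i by rewrite -xtq; apply: (half_step_gt0 j0).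
have step : ratio_le (1 + (1 - a / b) * (T - 1)) xt (half_step B r y).
  rewrite -[xt]xtq; apply: (@half_step_contract _ _ _ j0 B r yt y a b T) => //.
  by move=> j i; exact: Atab.
apply: ratio_le_trans step _ => //.
- by rewrite addr_ge0// mulr_ge0// subr_ge0// ler_pdivrMr// mul1r.
- by move=> i; apply: (half_step_gt0 j0).
move=> i k; rewrite /half_step /B.
have := xe i; have := xe k; have := xlo i.
move: (S'0 i) (S'0 k); rewrite /B.
set s := \sum_j _; set s' := \sum_j _ => s0 s'0.
rewrite !ler_norml => lo /andP[_ e2] /andP[e1 _].
set P := x i * s in e1 lo *; set Q := x k * s' in e2 *.
have -> : r i / s * x k = (s * s')^-1 * (r i * Q).
  by rewrite /Q; field; rewrite !gt_eqF.
have -> : (1 + 2 * eps * (b / a)) * (r k / s' * x i) =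
   (s * s')^-1 * ((1 + 2 * eps * (b / a)) * P * r k).
  by rewrite /P; field; rewrite !gt_eqF.
rewrite ler_wpM2l ?invr_ge0 ?mulr_ge0 ?(ltW s0) ?(ltW s'0)//.
(* Row i gives r_i <= P + eps r_i and row k gives Q <= (1 + eps) r_k, hence two terms eps r_i; the
   lower bound on P absorbs both. *)
have e3 : 2 * eps * r i <= 2 * eps * (b / a * P).
  rewrite ler_wpM2l ?mulr_ge0//.
  by move: lo; rewrite mulrAC ler_pdivrMr// (mulrAC b) ler_pdivlMr// mulrC (mulrC b).
apply: (@le_trans _ _ (r i * ((1 + eps) * r k))).
  by rewrite ler_wpM2l ?(ltW (r0 _))//; lra.
rewrite mulrA ler_wpM2r ?(ltW (r0 _))//.
lra.
Qed.

(** [ratio_le] sees vectors only up to a scalar; agreement at [i0] fixes the scalar and turns ratios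
    into bounds on single coordinates. *)
Lemma normalized_ratio {I : finType} (i0 i : I) (xt x : I -> R) T :
  (forall i, 0 < x i) -> xt i0 = x i0 -> ratio_le T xt x ->
  xt i <= T * x i /\ x i <= T * xt i.
Proof.
move=> x0 E h; have := h i i0; have := h i0 i; rewrite E => h1 h2; split.
  by rewrite -(ler_pM2r (x0 i0)) -mulrA (mulrC (x i)).
by rewrite -(ler_pM2r (x0 i0)) -mulrA (mulrC (x i)).
Qed.

(** The rows are pinned at [i0], so T - 1 controls them directly. The columns have no pinned
    coordinate: their error is read off the column equations, which costs one more eps and one more
    factor b / a. *)
Lemma scaling_stability {I J : finType} (i0 : I) (j0 : J) (At A : I -> J -> R)
    (r xt x : I -> R) (c yt y : J -> R) (a b eps : R) :
  0 < a -> a <= b -> 0 <= eps ->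
  (forall i j, a <= At i j <= b) -> (forall i j, a <= A i j <= b) ->
  (forall i, 0 < r i) -> (forall j, 0 < c j) ->
  (forall i, 0 < xt i) -> (forall i, 0 < x i) ->
  (forall j, 0 < yt j) -> (forall j, 0 < y j) ->
  (forall i, xt i * \sum_j At i j * yt j = r i) ->
  (forall j, yt j * \sum_i At i j * xt i = c j) ->
  (forall i, x i * \sum_j A i j * y j = r i) ->
  (forall j, y j * \sum_i A i j * x i = c j) ->
  (forall i, `|x i * \sum_j At i j * y j - r i| <= eps * r i) ->
  (forall j, `|y j * \sum_i At i j * x i - c j| <= eps * c j) ->
  xt i0 = x i0 ->
  (forall i, `|xt i - x i| <= 3 * (b / a) ^+ 5 * eps * x i) /\
  (forall j, `|yt j - y j| <= 3 * (b / a) ^+ 5 * eps * y j).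
Proof.
move=> a0 ab e0 Atab Aab r0 c0 xt0 x0 yt0 y0 xtE ytE xE yE xe ye xn.
have b0 : 0 < b by exact: lt_le_trans ab.
set K := b / a.
have K1 : 1 <= K by rewrite ler_pdivlMr// mul1r.
have K0 : 0 < K by exact: lt_le_trans K1.
have Ki : a / b = K^-1 by rewrite /K invf_div.
have Ki1 : K^-1 <= 1 by rewrite invf_le1.
(* All entries lie in [a, b], so [At] dominates a / b times [A] entrywise. This bounds the
   approximate row and column sums from below, whatever eps is. *)
have At_lo i j : K^-1 * A i j <= At i j.
  case/andP: (Atab i j) (Aab i j) => h1 _ /andP[_ h2].
  by apply: le_trans h1; rewrite -Ki mulrAC ler_pdivrMr// ler_wpM2l// ltW.
have xlo i : a / b * r i <= x i * \sum_j At i j * y j.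
  rewrite -xE Ki mulrCA ler_wpM2l ?(ltW (x0 _))// mulr_sumr.
  by apply: ler_sum => j _; rewrite mulrA ler_wpM2r ?(ltW (y0 _)).
have ylo j : a / b * c j <= y j * \sum_i At i j * x i.
  rewrite -yE Ki mulrCA ler_wpM2l ?(ltW (y0 _))// mulr_sumr.
  by apply: ler_sum => i _; rewrite mulrA ler_wpM2r ?(ltW (x0 _)).
have apx := scaled_ratio_apriori j0 a0 Atab Aab r0 yt0 y0 xtE xE.
have apy := scaled_ratio_apriori i0 a0 (fun j i => Atab i j)
  (fun j i => Aab i j) c0 xt0 x0 ytE yE.
have [i1 [i2]] := ratio_max_attained i0 xt0 x0.
have [j1 [j2]] := ratio_max_attained j0 yt0 y0.
set ty := _ / _ => hy; set tx := _ / _ => hx.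
pose f T := (1 + (1 - a / b) * (T - 1)) * (1 + 2 * eps * (b / a)).
have entx T : ratio_le T xt x -> tx <= T.
  by move=> h; rewrite /tx ler_pdivrMr ?mulr_gt0//; exact: h.
have enty T : ratio_le T yt y -> ty <= T.
  by move=> h; rewrite /ty ler_pdivrMr ?mulr_gt0//; exact: h.
have tx1 : 1 <= tx.
  by have := hx i1 i1; rewrite -[leLHS]mul1r ler_pM2r// mulr_gt0.
have ty1 : 1 <= ty.
  by have := hy j1 j1; rewrite -[leLHS]mul1r ler_pM2r// mulr_gt0.
have ratioW (L : finType) (u v : L -> R) (s t : R) : (forall l, 0 < u l) ->
    (forall l, 0 < v l) -> s <= t -> ratio_le s u v -> ratio_le t u v.
  move=> u0 v0 st h i k; apply: (le_trans (h i k)).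
  by rewrite ler_wpM2r// mulr_ge0// ltW.
pose T := Num.max tx ty.
have xT : ratio_le T xt x by apply: ratioW hx => //; rewrite le_max lexx.
have yT : ratio_le T yt y by apply: ratioW hy => //; rewrite le_max lexx orbT.
have T1 : 1 <= T by rewrite le_max tx1.
have Tf : T <= f T.
  rewrite ge_max; apply/andP; split.
    exact: entx (scaled_ratio_step j0 a0 ab e0 T1 Atab r0 x0 yt0 y0 xtE xe xlo yT).
  exact: enty (scaled_ratio_step i0 a0 ab e0 T1 (fun j i => Atab i j)
    c0 y0 xt0 x0 ytE ye ylo xT).
have TK : T <= K ^+ 2 by rewrite ge_max entx//= enty.
(* In T <= f T the contracted factor 1 + (1 - 1 / K) (T - 1) is at most T <= K^2. What multiplies
   eps is thus bounded, and the gain (T - 1) / K remains on the left. *)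
have TE : T - 1 <= 2 * eps * K ^+ 4.
  move: Tf; rewrite /f Ki -/K => Tf.
  have h : K^-1 * (T - 1) <= 2 * eps * K * K ^+ 2.
    have h1 : 1 + (1 - K^-1) * (T - 1) <= T.
      rewrite -lerBrDl ler_piMl ?subr_ge0//.
      by rewrite gerBl invr_ge0 ltW.
    have h2 : 2 * eps * K * (1 + (1 - K^-1) * (T - 1)) <= 2 * eps * K * K ^+ 2.
      apply: ler_wpM2l (le_trans h1 TK); exact: mulr_ge0 (mulr_ge0 _ e0) (ltW K0).
    lra.
  move: h; rewrite mulrC ler_pdivrMr// => /le_trans; apply.
  by rewrite (_ : 2 * eps * K * K ^+ 2 * K = 2 * eps * K ^+ 4)//; ring.
(* One bound for rows and columns; with T - 1 <= 2 eps K^4 and eps <= eps K^4 it yields the constant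
   3 K^5. *)
pose L := K * (T - 1 + eps).
have LE : L <= 3 * K ^+ 5 * eps.
  have -> : 3 * K ^+ 5 * eps = K * (2 * eps * K ^+ 4 + eps * K ^+ 4) by ring.
  rewrite ler_wpM2l ?(ltW K0)// lerD//.
  by rewrite ler_peMr// exprn_ege1.
have TL : T - 1 <= L.
  have : T - 1 + eps <= L by rewrite ler_peMl// addr_ge0// subr_ge0.
  lra.
split.
  move=> i; apply: (@le_trans _ _ (L * x i)); last by rewrite ler_wpM2r ?(ltW (x0 _)).
  have [h1 h2] := normalized_ratio i x0 xn xT.
  have h3 : (T - 1) * x i <= L * x i by rewrite ler_wpM2r ?(ltW (x0 _)).
  rewrite ler_norml; apply/andP; split; last by lra.
  (* From x_i <= T xt_i one gets T (x_i - xt_i) <= (T - 1) x_i, and T >= 1 finishes. Multiplying by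
     T avoids a division. *)
  have h4 : T * (x i - xt i) <= T * ((T - 1) * x i).
    have : 0 <= (T - 1) ^+ 2 * x i by rewrite mulr_ge0 ?sqr_ge0 ?(ltW (x0 _)).
    nra.
  by have := h4; rewrite ler_pM2l; [lra|exact: lt_le_trans T1].
move=> j; apply: (@le_trans _ _ (L * y j)); last by rewrite ler_wpM2r ?(ltW (y0 _)).
have T0 : 0 < T by exact: lt_le_trans T1.
have At0 i k : 0 < At i k by case/andP: (Atab i k) => h _; exact: lt_le_trans h.
have S0 : 0 < \sum_i At i j * x i by apply: sum_gt0 => // i; exact: mulr_gt0.
have St0 : 0 < \sum_i At i j * xt i by apply: sum_gt0 => // i; exact: mulr_gt0.
have up : \sum_i At i j * xt i <= T * \sum_i At i j * x i.
  rewrite mulr_sumr; apply: ler_sum => i _; rewrite mulrCA ler_wpM2l ?(ltW (At0 _ _))//.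
  by case: (normalized_ratio i x0 xn xT).
have dn : \sum_i At i j * x i <= T * \sum_i At i j * xt i.
  rewrite mulr_sumr; apply: ler_sum => i _; rewrite mulrCA ler_wpM2l ?(ltW (At0 _ _))//.
  by case: (normalized_ratio i x0 xn xT).
move: (ytE j) (ye j) (ylo j) S0 St0 up dn.
set s := \sum_i _; set s' := \sum_i _ => sE; rewrite -{}sE ler_norml Ki.
move=> /andP[e1 e2] lo s'0 s0 up dn.
(* Here c_j is [yt j * s]. The lower bound c_j / K <= y_j s' turns an error (T - 1 + eps) c_j into L
   y_j s'. *)
have Ls : K * (T - 1 + eps) * (K^-1 * (yt j * s)) = (T - 1 + eps) * (yt j * s).
  by field; rewrite !gt_eqF.
have Lp : (T - 1 + eps) * (yt j * s) <= L * (y j * s').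
  rewrite -Ls ler_wpM2l// mulr_ge0 ?(ltW K0)// addr_ge0// subr_ge0//.
have ytj := yt0 j; have yj := y0 j.
have u1 : yt j * s <= T * (yt j * s') by rewrite mulrCA ler_wpM2l// ltW.
have u2 : yt j * s' <= T * (yt j * s) by rewrite mulrCA ler_wpM2l// ltW.
rewrite ler_norml; apply/andP; split.
  rewrite -(ler_pM2r s'0) -(ler_pM2l T0).
  have : T * (T - 1 + eps) * (yt j * s) <= T * (L * (y j * s')).
    by rewrite -mulrA ler_wpM2l// ltW.
  have : T * (y j * s') <= T * ((1 + eps) * (yt j * s)).
    rewrite ler_wpM2l ?(ltW T0)//; lra.
  have : 0 <= (T - 1) ^+ 2 * (yt j * s).
    by rewrite mulr_ge0 ?sqr_ge0// mulr_ge0// ltW.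
  nra.
rewrite -(ler_pM2r s'0).
lra.
Qed.

End Stability.

(** * Convergence of Sinkhorn's iteration *)

Section Sinkhorn.
Context {R : realType}.

Lemma cvg_geometric_increments (w : R^nat) (K kappa : R) : 0 <= kappa < 1 ->
  0 <= K -> (forall n, `|w n.+1 - w n| <= K * kappa ^+ n) -> cvgn w.
Proof.
move=> /andP[k0 k1] K0 h.
have -> : w = (fun n => w 0%N + series (telescope w) n).
  by apply/funext => n; exact: eq_sum_telescope.
apply: is_cvgD; first exact: is_cvg_cst.
apply: normed_cvg; apply: (@series_le_cvg _ _ (geometric K kappa)) => //.
- by move=> n; exact: normr_ge0.
- by move=> n; rewrite /geometric /= mulr_ge0// exprn_ge0.
- by apply: is_cvg_geometric_series; rewrite ger0_norm.
Qed.

Lemma half_step_cvg {I J : finType} (A : I -> J -> R) c (u : nat -> I -> R)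
    (l : I -> R) j : 0 < \sum_i A i j * l i ->
  (forall i, u ^~ i @ \oo --> l i) ->
  (fun n => half_step A c (u n) j) @ \oo --> half_step A c l j.
Proof.
move=> s0 ul; apply: cvgM; first exact: cvg_cst.
apply: cvgV; first by rewrite gt_eqF.
apply: cvg_big => [x|i _]; last by apply: cvgM; [exact: cvg_cst|exact: ul].
exact: add_continuous.
Qed.

(** Degree -1 for a half-step means degree 1 for a full step, so normalization may be done before or
    after a step. *)
Lemma half_step_scale {I J : finType} (A : I -> J -> R) c (u : I -> R) (k : R) :
  half_step A c (fun i => k * u i) = (fun j => k^-1 * half_step A c u j).
Proof.
apply/funext => j; rewrite /half_step.
under eq_bigr do rewrite mulrCA.
by rewrite -mulr_sumr invfM mulrCA.
Qed.

(** The bound does not depend on [u]: after one step the normalized iterates stay away from 0 and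
    from infinity. *)
Lemma half_step_bounds {I J : finType} (i0 : I) (A : I -> J -> R) c u
    (a b : R) j l : 0 < a -> (forall i j, a <= A i j <= b) ->
  (forall i, 0 < u i) -> (forall j, 0 < c j) ->
  half_step A c u j <= (c j / c l) * (b / a) * half_step A c u l.
Proof.
move=> a0 Aab u0 c0.
have U0 : 0 < \sum_i u i by exact: sum_gt0.
have /andP[h1 _] := weighted_sum_bounds (fun i => Aab i j) u0.
have /andP[_ h2] := weighted_sum_bounds (fun i => Aab i l) u0.
have A0 i k : 0 < A i k by case/andP: (Aab i k) => h _; exact: lt_le_trans h.
have s0 k : 0 < \sum_i A i k * u i by apply: sum_gt0 => // i; exact: mulr_gt0.
have b0 : 0 < b.
  by apply: (lt_le_trans a0); case/andP: (Aab i0 j) => v w; exact: le_trans v w.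
rewrite /half_step; move: (s0 j) (s0 l) h1 h2.
set s := \sum_i _; set s' := \sum_i _ => {}s0 s'0 h1 h2.
have -> : c j / c l * (b / a) * (c l / s') = (c j / s / s' / a) * (b * s).
  by field; rewrite !gt_eqF.
rewrite [leLHS](_ : _ = (c j / s / s' / a) * (a * s')); last by field; rewrite !gt_eqF.
apply: ler_wpM2l; first by rewrite !divr_ge0// ltW.
apply: (@le_trans _ _ (a * (b * \sum_i u i))); first by rewrite ler_wpM2l// ltW.
by rewrite mulrCA ler_wpM2l// ltW.
Qed.

Context {I J : finType} (i0 : I) (j0 : J) (r : I -> R) (c : J -> R).

Definition sinkhorn_step (A : I -> J -> R) (u : I -> R) : I -> R :=
  half_step (fun j i => A i j) r (half_step A c u).

Definition sinkhorn (A : I -> J -> R) (n : nat) : I -> R :=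
  iter n (sinkhorn_step A) (fun=> 1).

Definition sinkhorn_normalized (A : I -> J -> R) (n : nat) (i : I) : R :=
  sinkhorn A n i / sinkhorn A n i0.

Hypothesis r0 : forall i, 0 < r i.
Hypothesis c0 : forall j, 0 < c j.

Lemma sinkhorn_step_gt0 (A : I -> J -> R) (u : I -> R) : (forall i j, 0 < A i j) -> (forall i, 0 < u i) ->
  forall i, 0 < sinkhorn_step A u i.
Proof.
move=> A0 u0; apply: (half_step_gt0 j0) => //.
by move=> j; exact: (half_step_gt0 i0).
Qed.

Lemma sinkhorn_gt0 (A : I -> J -> R) n i : (forall i j, 0 < A i j) -> 0 < sinkhorn A n i.
Proof.
move=> A0; elim: n i => [|n IH] i; first exact: ltr01.
by rewrite /sinkhorn iterS; exact: sinkhorn_step_gt0.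
Qed.

(** The ratio of consecutive iterates tends to 1 geometrically, and normalization together with the
    uniform bounds turns this into geometrically small increments in each coordinate. The uniform
    lower bound keeps the limit positive. *)
Lemma sinkhorn_normalized_cvg (A : I -> J -> R) : (forall i j, 0 < A i j) ->
  exists u : I -> R, [/\ forall i, 0 < u i, u i0 = 1 &
    forall i, sinkhorn_normalized A ^~ i @ \oo --> u i].
Proof.
move=> A0.
have [[ia ja] /= ha] := finfun_min_attained (i0, j0) (fun p => A p.1 p.2).
have [[ib jb] /= hb] := finfun_max_attained (i0, j0) (fun p => A p.1 p.2).
(* The bounds come from the matrix itself, since only positivity is assumed. *)
pose a := A ia ja; pose b := A ib jb.
have Aab i j : a <= A i j <= b by rewrite (ha (i, j)) (hb (i, j)).
have a0 : 0 < a by exact: A0.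
have b0 : 0 < b by exact: A0.
have ab1 : a / b <= 1 by rewrite ler_pdivrMr// mul1r; exact: (ha (ib, jb)).
(* A full step consists of two half-steps, hence the square. *)
pose kappa := (1 - a / b) ^+ 2.
have kb : 0 <= kappa < 1.
  rewrite sqr_ge0/= expr_lt1// ?subr_ge0//.
  by rewrite gtrBl divr_gt0.
have s0 n i : 0 < sinkhorn A n i by exact: sinkhorn_gt0.
have [t0 [t01 h0]] : exists t, 1 <= t /\ ratio_le t (sinkhorn A 1) (sinkhorn A 0).
  have [i1 [i2 h]] := ratio_max_attained i0 (s0 1%N) (s0 0%N).
  eexists; split; last exact: h.
  by have := h i1 i1; rewrite -[leLHS]mul1r ler_pM2r// mulr_gt0.
pose t n := 1 + kappa ^+ n * (t0 - 1).
have ht n : ratio_le (t n) (sinkhorn A n.+1) (sinkhorn A n).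
  elim: n => [|n IH]; first by rewrite /t expr0 mul1r addrC subrK.
  have := @half_step_contract _ _ _ i0 A c _ _ a b _ a0 Aab c0 (s0 n.+1) (s0 n) IH.
  move/(@half_step_contract _ _ _ j0 (fun j i => A i j) r _ _ a b _ a0
    (fun j i => Aab i j) r0 (half_step_gt0 i0 A0 c0 (s0 n.+1))
    (half_step_gt0 i0 A0 c0 (s0 n))).
  rewrite (_ : 1 + _ * _ = t n.+1)//.
  by rewrite /t exprS /kappa; ring.
pose K i := r i / r i0 * (b / a).
have K0 i : 0 < K i by rewrite !mulr_gt0 ?invr_gt0.
have stepE n : sinkhorn A n.+1 = half_step (fun j i => A i j) r (half_step A c (sinkhorn A n)).
  by [].
have v0 n := half_step_gt0 i0 A0 c0 (s0 n).
have up n i : sinkhorn_normalized A n.+1 i <= K i.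
  rewrite /sinkhorn_normalized ler_pdivrMr// !stepE.
  exact: (half_step_bounds j0 i i0 a0 (fun j i => Aab i j) (v0 n) r0).
have lo n i : (r i0 / r i * (b / a))^-1 <= sinkhorn_normalized A n.+1 i.
  rewrite /sinkhorn_normalized ler_pdivlMr// ler_pdivrMl ?mulr_gt0 ?invr_gt0//.
  exact: (half_step_bounds j0 i0 i a0 (fun j i => Aab i j) (v0 n) r0).
have n1 n : sinkhorn_normalized A n i0 = 1 by rewrite /sinkhorn_normalized divff// gt_eqF.
have n0 n i : 0 < sinkhorn_normalized A n i by rewrite divr_gt0.
have hr n : ratio_le (t n) (sinkhorn_normalized A n.+1) (sinkhorn_normalized A n).
  move=> i k; rewrite /sinkhorn_normalized mulf_div [X in _ <= _ * X]mulf_div [leRHS]mulrA.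
  apply: ler_wpM2r (ht n i k); rewrite invr_ge0.
  exact: mulr_ge0 (ltW (s0 n.+1 i0)) (ltW (s0 n i0)).
have t1 n : 0 <= t n - 1.
  by rewrite /t addrC addKr mulr_ge0 ?subr_ge0// exprn_ge0//; case/andP: kb.
(* The index is shifted by one because the uniform bounds hold for outputs of a step, not for the
   constant starting vector. *)
have cv i : cvgn (fun n => sinkhorn_normalized A n.+1 i).
  apply: (@cvg_geometric_increments _ (K i * (kappa * (t0 - 1))) kappa) => //.
    by rewrite mulr_ge0 ?(ltW (K0 _))// mulr_ge0 ?subr_ge0//; case/andP: kb.
  move=> n.
  have [h1 h2] := normalized_ratio i (n0 n.+1) (etrans (n1 n.+2) (esym (n1 n.+1))) (hr n.+1).
  rewrite (_ : K i * _ * _ = (t n.+1 - 1) * K i); last by rewrite /t exprS; ring.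
  have k1 : (t n.+1 - 1) * sinkhorn_normalized A n.+1 i <= (t n.+1 - 1) * K i.
    by rewrite ler_wpM2l.
  have k2 : (t n.+1 - 1) * sinkhorn_normalized A n.+2 i <= (t n.+1 - 1) * K i.
    by rewrite ler_wpM2l.
  rewrite ler_norml; apply/andP; split; lra.
exists (fun i => limn (fun n => sinkhorn_normalized A n.+1 i)); split.
- move=> i; apply: (@lt_le_trans _ _ (r i0 / r i * (b / a))^-1).
    by rewrite invr_gt0 !mulr_gt0 ?invr_gt0.
  by apply: limr_ge => //; apply: nearW => n; exact: lo.
- under [X in limn X]eq_fun do rewrite n1.
  exact: lim_cst.
- by move=> i; rewrite -cvg_shiftS; exact: cv.
Qed.

Hypothesis rc : \sum_i r i = \sum_j c j.

(** By continuity the limit is fixed by the normalized step. The column sums are exact by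
    construction, and the row sums are [r] up to one scalar; equal total masses force this scalar to
    be 1. *)
Lemma sinkhorn_limit_scales (A : I -> J -> R) (u : I -> R) : (forall i j, 0 < A i j) ->
  (forall i, 0 < u i) -> u i0 = 1 ->
  (forall i, sinkhorn_normalized A ^~ i @ \oo --> u i) ->
  (forall i, u i * \sum_j A i j * half_step A c u j = r i) /\
  (forall j, half_step A c u j * \sum_i A i j * u i = c j).
Proof.
move=> A0 u0 u1 hu.
have s0 n i : 0 < sinkhorn A n i by exact: sinkhorn_gt0.
have su0 j : 0 < \sum_i A i j * u i by apply: (sum_gt0 i0) => i; exact: mulr_gt0.
have v0 j : 0 < half_step A c u j by exact: (half_step_gt0 i0).
have sv0 i : 0 < \sum_j A i j * half_step A c u j.
  by apply: (sum_gt0 j0) => j; exact: mulr_gt0.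
have colE j : half_step A c u j * \sum_i A i j * u i = c j.
  by rewrite /half_step divfK// gt_eqF.
have S0 i : 0 < sinkhorn_step A u i by exact: sinkhorn_step_gt0.
have Scv i : (fun n => sinkhorn_step A (sinkhorn_normalized A n) i) @ \oo -->
    sinkhorn_step A u i.
  by apply: half_step_cvg => // j; apply: half_step_cvg.
have SE n i : sinkhorn_normalized A n.+1 i =
    sinkhorn_step A (sinkhorn_normalized A n) i /
    sinkhorn_step A (sinkhorn_normalized A n) i0.
  have -> : sinkhorn_normalized A n = (fun i => (sinkhorn A n i0)^-1 * sinkhorn A n i).
    by apply/funext => k; rewrite /sinkhorn_normalized mulrC.
  rewrite /sinkhorn_step !half_step_scale !invrK.
  rewrite /sinkhorn_normalized /sinkhorn iterS -/(sinkhorn A n).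
  by rewrite -[RHS]mulf_div divff ?mul1r// invr_eq0 gt_eqF.
have fixE i : u i = sinkhorn_step A u i / sinkhorn_step A u i0.
  have h1 : (fun n => sinkhorn_normalized A n.+1 i) @ \oo --> u i.
    by have := hu i; rewrite -cvg_shiftS.
  have h2 : (fun n => sinkhorn_normalized A n.+1 i) @ \oo -->
      sinkhorn_step A u i / sinkhorn_step A u i0.
    under eq_fun do rewrite SE.
    by apply: cvgM => //; apply: cvgV => //; rewrite gt_eqF.
  by have := cvg_unique _ h1 h2; apply.
have rowE i : u i * \sum_j A i j * half_step A c u j = r i / sinkhorn_step A u i0.
  rewrite [u i]fixE {1}/sinkhorn_step {1}/half_step.
  by field; rewrite !gt_eqF//=; exact: sv0.
have lam : sinkhorn_step A u i0 = 1.
  (* Both sides are the total mass of the scaled matrix, summed by columns and by rows. *)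
  have h : \sum_j c j = (\sum_i r i) / sinkhorn_step A u i0.
    rewrite mulr_suml -(eq_bigr _ (fun i _ => rowE i)) -(eq_bigr _ (fun j _ => colE j)).
    under eq_bigr do rewrite mulr_sumr.
    under [RHS]eq_bigr do rewrite mulr_sumr.
    rewrite exchange_big/=; apply: eq_bigr => i _; apply: eq_bigr => j _.
    by ring.
  have C0 : 0 < \sum_j c j by exact: (sum_gt0 j0).
  move: h; rewrite rc => /(congr1 ( *%R^~ (sinkhorn_step A u i0))).
  rewrite divfK ?gt_eqF// => /(congr1 ( *%R ((\sum_j c j)^-1))).
  by rewrite mulKf ?gt_eqF// mulVf ?gt_eqF.
by split => // i; rewrite rowE lam divr1.
Qed.

End Sinkhorn.

(** * Independence and Hoeffding's inequality *)

Section Independence.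
Context {R : realType} {d : measure_display} {T : measurableType d}.
Variable P : probability T R.

Definition mkRV (f : T -> R) (mf : measurable_fun setT f) : {RV P >-> R} :=
  HB.pack_for {mfun T >-> R} f (isMeasurableFun.Build _ _ _ _ f mf).

Import HBNNSimple.

(** Passes from indicators to simple functions by linearity and on to nonnegative functions by
    monotone convergence. It is applied with [Y] the product of the factors at all other indices. *)
Lemma integral_weighted_comp (Y : T -> R) (X : {RV P >-> R}) (C : R) :
  measurable_fun setT Y -> (forall w, 0 <= Y w) -> 0 <= C ->
  (forall E, measurable E ->
     (\int[P]_w (Y w * \1_E (X w))%:E = C%:E * P (X @^-1` E))%E) ->
  forall f : R -> R, measurable_fun setT f -> (forall x, 0 <= f x) ->
  (\int[P]_w (Y w * f (X w))%:E = C%:E * \int[P]_w (f (X w))%:E)%E.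
Proof.
move=> mY Y0 C0 H f mf f0.
have mX : measurable_fun setT X by exact: measurable_funP.
have H1 (g : {nnsfun R >-> R}) :
    (\int[P]_w (Y w * g (X w))%:E = C%:E * \int[P]_w (g (X w))%:E)%E.
  have mI (k : R) : measurable_fun setT (fun w => (\1_(g @^-1` [set k]) (X w) : R)).
    by apply: (measurableT_comp _ mX); exact: measurable_indic.
  have gX w : g (X w) = \sum_(k \in range g) (k * \1_(g @^-1` [set k]) (X w)).
    by rewrite {1}(fimfunE g).
  have L1 : (\int[P]_w (g (X w))%:E =
      \sum_(k \in range g) (k%:E * P (X @^-1` (g @^-1` [set k]))))%E.
    under eq_integral do rewrite gX -fsumEFin//.
    rewrite ge0_integral_fsum//.
    - apply: eq_fsbigr => k /set_mem[x _ kE].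
      under eq_integral do rewrite EFinM.
      rewrite ge0_integralZl//.
      + congr (_ * _)%E.
        rewrite (_ : (fun w => _) = (fun w => (\1_(X @^-1` (g @^-1` [set k])) w)%:E))//.
        rewrite integral_indic ?setIT//.
        rewrite -[X in measurable X]setTI; apply: mX => //.
      + exact/measurable_EFinP.
      + by rewrite -kE lee_fin.
    - move=> k; apply/measurable_EFinP; exact: measurable_funM.
    - by move=> k w _; rewrite EFinM nnfun_muleindic_ge0.
  have L2 : (\int[P]_w (Y w * g (X w))%:E =
      \sum_(k \in range g) (k%:E * (C%:E * P (X @^-1` (g @^-1` [set k])))))%E.
    have E w : ((Y w * g (X w))%:E =
        \sum_(k \in range g) (k * (Y w * \1_(g @^-1` [set k]) (X w)))%:E)%E.
      rewrite gX fsumEFin//; congr EFin.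
      rewrite !fsbig_finite//= mulr_sumr; apply: eq_bigr => k _; ring.
    under eq_integral do rewrite E.
    rewrite ge0_integral_fsum//.
    - apply: eq_fsbigr => k /set_mem[x _ kE].
      under eq_integral do rewrite EFinM.
      rewrite ge0_integralZl//.
      + by rewrite H.
      + by apply/measurable_EFinP; exact: measurable_funM.
      + by move=> w _; rewrite lee_fin mulr_ge0.
      + by rewrite -kE lee_fin.
    - move=> k; apply/measurable_EFinP; apply: measurable_funM => //.
      exact: measurable_funM.
    - move=> k w _; rewrite mulrCA EFinM mule_ge0 ?lee_fin// -lee_fin EFinM.
      exact: nnfun_muleindic_ge0.
  rewrite L1 L2 ge0_mule_fsumr; last first.
    by move=> k; exact: (nnsfun_mulemu_ge0 (distribution P X) g k).
  by apply: eq_fsbigr => k _; rewrite muleCA.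
have mfE : measurable_fun setT (EFin \o f) by exact/measurable_EFinP.
pose g := nnsfun_approx measurableT mfE.
have gf x : EFin \o g^~ x @ \oo --> (f x)%:E.
  by apply: cvg_nnsfun_approx => // y _; rewrite lee_fin.
have nd x : nondecreasing_seq (g ^~ x).
  by move=> m n mn; have /lefP := nd_nnsfun_approx measurableT mfE mn; exact.
have mgX n : measurable_fun setT (fun w => g n (X w)).
  by apply: measurableT_comp.
have c1 : (\int[P]_w (g n (X w))%:E @[n --> \oo] --> \int[P]_w (f (X w))%:E)%E.
  have -> : (\int[P]_w (f (X w))%:E = \int[P]_w limn (fun n => (g n (X w))%:E))%E.
    by apply: eq_integral => w _; apply/esym/cvg_lim => //; exact: gf.
  apply: cvg_monotone_convergence => //.
  - by move=> n; exact/measurable_EFinP.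
  - by move=> n w _; rewrite lee_fin.
  - by move=> w _ m n mn; rewrite lee_fin; exact: nd.
have c2 : (\int[P]_w (Y w * g n (X w))%:E @[n --> \oo] --> \int[P]_w (Y w * f (X w))%:E)%E.
  have -> : (\int[P]_w (Y w * f (X w))%:E = \int[P]_w limn (fun n => (Y w * g n (X w))%:E))%E.
    apply: eq_integral => w _; apply/esym/cvg_lim => //.
    under eq_fun do rewrite EFinM.
    by rewrite EFinM; apply: cvgeZl => //; exact: gf.
  apply: cvg_monotone_convergence => //.
  - by move=> n; apply/measurable_EFinP; exact: measurable_funM.
  - by move=> n w _; rewrite lee_fin mulr_ge0.
  - by move=> w _ m n mn; rewrite lee_fin ler_wpM2l//; exact: nd.
have E : (fun n => \int[P]_w (Y w * g n (X w))%:E)%E =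
    (fun n => C%:E * \int[P]_w (g n (X w))%:E)%E.
  by apply/funext => n; exact: H1.
rewrite E in c2.
have c3 := cvgeZl (isT : C%:E \is a fin_num) c1.
exact: (cvg_unique _ c2 c3).
Qed.

(* Indicator factors are replaced by general functions one index at a time. *)
Lemma independent_integral_prod {I : finType} (X : I -> {RV P >-> R}) :
  mutually_independent P X ->
  forall (f : I -> R -> R) (m : I -> R),
  (forall i, measurable_fun setT (f i)) -> (forall i x, 0 <= f i x) ->
  (forall i, \int[P]_w (f i (X i w))%:E = (m i)%:E)%E ->
  (\int[P]_w (\prod_i f i (X i w))%:E = (\prod_i m i)%:E)%E.
Proof.
move=> indep.
have mX i : measurable_fun setT (X i) by exact: measurable_funP.
have mXE i E : measurable E -> measurable (X i @^-1` E).
  by move=> mE; rewrite -[X in measurable X]setTI; exact: mX.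
have Pfin i E : measurable E -> P (X i @^-1` E) = (fine (P (X i @^-1` E)))%:E.
  by move=> mE; rewrite fineK// fin_num_measure//; exact: mXE.
(* Induction on the list of indices whose factor is still arbitrary; off the list the factors are
   indicators. *)
suff main (s : seq I) : forall (f : I -> R -> R) (m : I -> R),
    (forall i, i \notin s -> exists2 E, measurable E & f i = \1_E) ->
    (forall i, measurable_fun setT (f i)) -> (forall i x, 0 <= f i x) ->
    (forall i, \int[P]_w (f i (X i w))%:E = (m i)%:E)%E ->
    (\int[P]_w (\prod_i f i (X i w))%:E = (\prod_i m i)%:E)%E.
  move=> f m mf f0 fm; apply: (main (enum I)) => // i.
  by rewrite mem_enum.
elim: s => [|i0 s IH] f m fE mf f0 fm.
  (* With indicators only, the product is the indicator of the intersection, and the definition of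
     independence applies. *)
  have /choice[E HE] : forall i, exists E, measurable E /\ f i = \1_E.
    by move=> i; case: (fE i) => // E mE e; exists E.
  have mE i : m i = fine (P (X i @^-1` E i)).
    apply: EFin_inj; rewrite -fm -Pfin; last by case: (HE i).
    case: (HE i) => mEi ->.
    rewrite (_ : (fun w => _) = (fun w => (\1_(X i @^-1` E i) w)%:E))//.
    by rewrite integral_indic ?setIT//; exact: mXE.
  have -> : (\int[P]_w (\prod_i f i (X i w))%:E =
      \int[P]_w (\1_(\bigcap_(i in [set: I]) (X i @^-1` E i)) w)%:E)%E.
    apply: eq_integral => w _; congr EFin.
    under eq_bigr do rewrite (HE _).2 indicE.
    rewrite indicE; case: (boolP (w \in _)) => [/set_mem h|/negP h] /=.
      rewrite big1// => i _; rewrite mem_set//; exact: h.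
    have [i hi] : exists i, ~ (E i (X i w)).
      by apply: contrapT => /forallNP k; apply: h; apply/mem_set => i _; exact: (contrapT (k i)).
    by rewrite (bigD1 i)//= memNset// mul0r.
  rewrite integral_indic ?setIT//; last first.
    by apply: fin_bigcap_measurable => // i _; apply: mXE; case: (HE i).
  apply: etrans (indep E _) _; first by move=> i; case: (HE i).
  rewrite -prodEFin; apply: eq_bigr => i _.
  by rewrite mE -Pfin//; case: (HE i).
have m0 i : 0 <= m i by rewrite -lee_fin -fm integral_ge0// => w _; rewrite lee_fin.
pose Y w := \prod_(i | i != i0) f i (X i w).
have step : forall f' : R -> R, measurable_fun setT f' -> (forall x, 0 <= f' x) ->
    (\int[P]_w (Y w * f' (X i0 w))%:E =
     (\prod_(i | i != i0) m i)%:E * \int[P]_w (f' (X i0 w))%:E)%E.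
  apply: integral_weighted_comp.
  - rewrite /Y; under eq_fun do rewrite -big_filter.
    by apply: measurable_prod => i _; apply: measurableT_comp.
  - by move=> w; apply: prodr_ge0.
  - by apply: prodr_ge0.
  (* Replacing the factor at [i0] by an indicator shortens the list, so the induction hypothesis
     gives the identity on indicators. *)
  - move=> E mE.
    pose f' i : R -> R := if i == i0 then \1_E else f i.
    pose m' i := if i == i0 then fine (P (X i0 @^-1` E)) else m i.
    have prodE w : \prod_i f' i (X i w) = Y w * \1_E (X i0 w).
      rewrite (bigD1 i0)//= /f' eqxx mulrC; congr (_ * _).
      by apply: eq_bigr => i /negbTE ->.
    have prodm : \prod_i m' i = (\prod_(i | i != i0) m i) * fine (P (X i0 @^-1` E)).
      rewrite (bigD1 i0)//= /m' eqxx mulrC; congr (_ * _).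
      by apply: eq_bigr => i /negbTE ->.
    rewrite (Pfin i0 E mE) -EFinM -prodm -(IH f' m').
    + by apply: eq_integral => w _; rewrite prodE.
    + move=> i is_; rewrite /f'; case: ifPn => [_|ii0]; first by exists E.
      by apply: fE; rewrite inE negb_or ii0.
    + by move=> i; rewrite /f'; case: ifP.
    + by move=> i x; rewrite /f'; case: ifP.
    + move=> i; rewrite /f' /m'; case: ifPn => // /eqP ->.
      rewrite (_ : (fun w => _) = (fun w => (\1_(X i0 @^-1` E) w)%:E))//.
      rewrite integral_indic; [|exact: measurableT|exact: mXE].
      rewrite setIT; exact: Pfin.
under eq_integral do rewrite (bigD1 i0)//= mulrC -/(Y _).
by rewrite step// fm -EFinM mulrC [in RHS](bigD1 i0).
Qed.
End Independence.

(** * Exponential moments of bounded centered variables and the one-sided Hoeffding bound *)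

Section Hoeffding.
Context {R : realType} {d : measure_display} {T : measurableType d}.
Variable P : probability T R.

(** The linear term will vanish on centered variables. For z <= 1/2, exp z <= 1 / (1 - z) <= 1 + z +
    2 z^2; for z > 1/2, z <= 2 z^2 and monotonicity suffices. *)
Lemma expR_le_addr_expR_sqr (z : R) : expR z <= z + expR (2 * z ^+ 2).
Proof.
have z2 : 0 <= z ^+ 2 by exact: sqr_ge0.
have [hz|hz] := leP z (1 / 2).
  have h1 : 1 + 2 * z ^+ 2 <= expR (2 * z ^+ 2) by exact: expR_ge1Dx.
  have h2 : 1 - z <= expR (- z) by have := expR_ge1Dx (- z).
  have e0 : 0 < expR z by exact: expR_gt0.
  have h3 : expR z * (1 - z) <= 1.
    by rewrite -[leRHS](expRxMexpNx_1 z) ler_wpM2l// ltW.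
  have h4 : 1 <= (1 + z + 2 * z ^+ 2) * (1 - z) by nra.
  have h5 : expR z <= 1 + z + 2 * z ^+ 2.
    have p : 0 < 1 - z by lra.
    by rewrite -(ler_pM2r p); exact: le_trans h4.
  lra.
apply: (@le_trans _ _ (expR (2 * z ^+ 2))); last by lra.
by rewrite ler_expR; nra.
Qed.

Lemma bounded_integrable (f : T -> R) (D : R) : measurable_fun setT f ->
  (forall w, `|f w| <= D) -> P.-integrable setT (EFin \o f).
Proof.
move=> mf fD; apply: measurable_bounded_integrable => //.
  by rewrite -ge0_fin_numE ?fin_num_measure.
exists D; split; first exact: num_real.
by move=> x Dx w _; exact: le_trans (fD w) (ltW Dx).
Qed.

Lemma integral_cst_probability (k : R) : (\int[P]_w k%:E = k%:E)%E.
Proof. by rewrite integral_cst//= probability_setT mule1. Qed.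

Lemma integral_expR_centered (Z : T -> R) (D : R) : measurable_fun setT Z ->
  (forall w, `|Z w| <= D) -> (\int[P]_w (Z w)%:E = 0)%E ->
  (\int[P]_w (expR (Z w))%:E <= (expR (2 * D ^+ 2))%:E)%E.
Proof.
move=> mZ ZD Z0.
have iZ := bounded_integrable mZ ZD.
have mE : measurable_fun setT (fun w => expR (Z w)).
  by apply: measurableT_comp => //; exact: measurable_expR.
have iE : P.-integrable setT (EFin \o (fun w => expR (Z w))).
  apply: (@bounded_integrable _ (expR D)) => // w.
  rewrite ger0_norm ?expR_ge0// ler_expR.
  by have := ZD w; rewrite ler_norml => /andP[].
have ic : P.-integrable setT (EFin \o (cst (expR (2 * D ^+ 2)) : T -> R)).
  by apply: (@bounded_integrable _ (expR (2 * D ^+ 2))) => // w; rewrite ger0_norm ?expR_ge0.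
apply: (@le_trans _ _ (\int[P]_w ((Z w)%:E + (expR (2 * D ^+ 2))%:E))%E).
  apply: le_integral => //; first exact: integrableD.
  move=> w _; rewrite -EFinD lee_fin (le_trans (expR_le_addr_expR_sqr _))//.
  rewrite lerD2l ler_expR ler_wpM2l//.
  rewrite -(real_normK (num_real (Z w))).
  by rewrite lerXn2r ?nnegrE//; exact: le_trans (ZD w).
by rewrite integralD// Z0 add0e integral_cst_probability.
Qed.

Lemma chernoff_integral (S : T -> R) (lam s m : R) : measurable_fun setT S ->
  0 < lam -> (\int[P]_w (expR (lam * S w))%:E <= m%:E)%E ->
  (P [set w | (s <= S w)%R] <= (m * expR (- (lam * s)))%:E)%E.
Proof.
move=> mS l0 h.
have := @chernoff _ _ _ P (mkRV P mS) lam s l0.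
rewrite /mmt_gen_fun unlock => h1; apply: (le_trans h1).
rewrite EFinM lee_wpmul2r ?lee_fin ?expR_ge0//.
apply: le_trans h; rewrite le_eqVlt; apply/orP; left; apply/eqP.
by apply: eq_integral => w _ /=; rewrite mulrC.
Qed.

Lemma itv_integrable (X : {RV P >-> R}) (a b : R) :
  (forall w, a <= X w <= b) -> P.-integrable setT (EFin \o X).
Proof.
move=> Xab; apply: (@bounded_integrable _ (`|a| + `|b|)) => // w.
case/andP: (Xab w) => h1 h2.
have := ler_norm (- a); rewrite normrN => h3.
rewrite ler_norml; apply/andP; split.
  by have := normr_ge0 b; lra.
by have := ler_norm b; have := normr_ge0 a; lra.
Qed.

Lemma expectation_bounds (X : {RV P >-> R}) (a b : R) :
  (forall w, a <= X w <= b) -> a <= fine ('E_P[X])%E <= b.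
Proof.
move=> Xab; have iX := itv_integrable Xab.
have cst_int (k : R) : P.-integrable setT (EFin \o (cst k : T -> R)).
  by apply: (@bounded_integrable _ `|k|).
have fin := integrable_fin_num measurableT iX.
rewrite unlock -!lee_fin fineK//; apply/andP; split.
  rewrite -[leLHS]integral_cst_probability.
  apply: le_integral; [exact: measurableT|exact: (cst_int a)|exact: iX|].
  by move=> w _; rewrite lee_fin; case/andP: (Xab w).
rewrite -[leRHS]integral_cst_probability.
apply: le_integral; [exact: measurableT|exact: iX|exact: (cst_int b)|].
by move=> w _; rewrite lee_fin; case/andP: (Xab w).
Qed.

(** Independence factors the exponential moment, and each factor is subgaussian. [V] is only an
    upper bound on the sum of squares, so that it can be positive even when a = b. *)
Lemma hoeffding_bounded {I : finType} (X : I -> {RV P >-> R}) (q : I -> R)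
    (a b V s : R) : mutually_independent P X ->
  (forall i w, a <= X i w <= b) ->
  (b - a) ^+ 2 * \sum_i q i ^+ 2 <= V -> 0 < V -> 0 < s ->
  (P [set w | (s <= \sum_i q i * (X i w - fine ('E_P[X i])%E))%R]
    <= (expR (- (s ^+ 2 / (8 * V))))%:E)%E.
Proof.
move=> indep Xab qV V0 s0.
pose mu i := fine ('E_P[X i])%E.
have mX i : measurable_fun setT (X i) by exact: measurable_funP.
have iX i : P.-integrable setT (EFin \o X i) by exact: itv_integrable (Xab i).
have EX i : (\int[P]_w (X i w)%:E = (mu i)%:E)%E.
  by rewrite /mu unlock fineK//; apply: (integrable_fin_num measurableT (iX i)).
have mu_ab i : a <= mu i <= b by exact: expectation_bounds.
(* The minimizer of 2 lam^2 V - lam s, where the value is - s^2 / (8 V). *)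
pose lam := s / (4 * V).
have lam0 : 0 < lam by rewrite divr_gt0// mulr_gt0.
pose f i (x : R) := expR (lam * (q i * (x - mu i))).
have mf i : measurable_fun setT (f i).
  apply: measurableT_comp; first exact: measurable_expR.
  by do 2 apply: measurable_funM => //; exact: measurable_funB.
have D_le i w : `|lam * (q i * (X i w - mu i))| <= lam * `|q i| * (b - a).
  rewrite normrM (ger0_norm (ltW lam0)) normrM -mulrA ler_wpM2l ?(ltW lam0)//.
  rewrite ler_wpM2l// ler_norml.
  by case/andP: (Xab i w) (mu_ab i) => h1 h2 /andP[h3 h4]; apply/andP; split; lra.
have mZ i : measurable_fun setT (fun w => lam * (q i * (X i w - mu i))).
  by do 2 apply: measurable_funM => //; exact: measurable_funB.
have iZ0 i : (\int[P]_w (lam * (q i * (X i w - mu i)))%:E = 0)%E.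
  under eq_integral do rewrite mulrA EFinM.
  have mB : P.-integrable setT (EFin \o (cst (mu i) : T -> R)).
    by apply: (@bounded_integrable _ `|mu i|).
  rewrite integralZl//; last first.
    exact: (integrableB measurableT (iX i) mB).
  have -> : (\int[P]_w (X i w - mu i)%:E = 0)%E.
    apply: etrans (integralB measurableT (iX i) mB) _.
    apply: etrans (congr2 (fun u v => u - v)%E (EX i) (integral_cst_probability _)) _.
    by rewrite subee.
  by rewrite mule0.
have mgf i : (\int[P]_w (f i (X i w))%:E <=
    (expR (2 * (lam * `|q i| * (b - a)) ^+ 2))%:E)%E.
  exact: (integral_expR_centered (mZ i) (D_le i) (iZ0 i)).
have mgf0 i : (0 <= \int[P]_w (f i (X i w))%:E)%E.
  by apply: integral_ge0 => w _; rewrite lee_fin expR_ge0.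
pose m i := fine (\int[P]_w (f i (X i w))%:E)%E.
have mE i : (\int[P]_w (f i (X i w))%:E = (m i)%:E)%E.
  rewrite /m fineK// ge0_fin_numE//; apply: le_lt_trans (mgf i) _; exact: ltry.
have prodE := independent_integral_prod indep mf (fun i x => expR_ge0 _) mE.
have mS : measurable_fun setT (fun w => \sum_i q i * (X i w - mu i)).
  apply: measurable_sum => i.
  by apply: measurable_funM => //; exact: measurable_funB.
have bound : \prod_i m i <= expR (2 * lam ^+ 2 * V).
  apply: (@le_trans _ _ (\prod_i expR (2 * (lam * `|q i| * (b - a)) ^+ 2))).
    apply: ler_prod => i _; apply/andP; split.
      by rewrite -lee_fin -mE.
    by rewrite -lee_fin -mE.
  rewrite -expR_sum ler_expR.
  have -> : \sum_i 2 * (lam * `|q i| * (b - a)) ^+ 2 =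
      2 * lam ^+ 2 * ((b - a) ^+ 2 * \sum_i q i ^+ 2).
    rewrite !mulr_sumr; apply: eq_bigr => i _.
    by rewrite -(real_normK (num_real (q i))); ring.
  by rewrite ler_wpM2l// mulr_ge0// sqr_ge0.
have S_int : (\int[P]_w (expR (lam * \sum_i q i * (X i w - mu i)))%:E <=
    (expR (2 * lam ^+ 2 * V))%:E)%E.
  rewrite -lee_fin -prodE in bound; apply: le_trans bound.
  rewrite le_eqVlt; apply/orP; left; apply/eqP; apply: eq_integral => w _.
  by rewrite /f -expR_sum -mulr_sumr.
apply: (le_trans (chernoff_integral s mS lam0 S_int)).
rewrite lee_fin -expRD ler_expR /lam.
rewrite le_eqVlt; apply/orP; left; apply/eqP.
by field; rewrite gt_eqF.
Qed.

End Hoeffding.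

(** * Almost sure bounds, clamping and the two-sided Hoeffding bound *)

Section AlmostSure.
Context {R : realType} {d : measure_display} {T : measurableType d}.
Variable P : probability T R.

Lemma ae_le_measure (A B : set T) : measurable A -> measurable B ->
  {ae P, forall w, A w -> B w} -> (P A <= P B)%E.
Proof.
move=> mA mB [N [mN N0 AN]].
apply: (@le_trans _ _ (P (B `|` N))).
  apply: le_measure; rewrite ?inE//; first exact: measurableU.
  move=> w Aw; have [Bw|nBw] := pselect (B w); first by left.
  by right; apply: AN => /= h; apply: nBw; exact: h.
by rewrite -[leRHS]adde0 -[in leRHS]N0; exact: measureU2.
Qed.

Lemma ae_forall_fin {I : finType} (Q : I -> T -> Prop) :
  (forall i, {ae P, forall w, Q i w}) -> {ae P, forall w, forall i, Q i w}.
Proof.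
move=> h.
have : {ae P, forall w, forall i, i \in enum I -> Q i w}.
  elim: (enum I) => [|i s IH]; first by apply: aeW => w i.
  apply: filterS2 (h i) IH => w Qi Qs k; rewrite inE => /orP[/eqP->//|]; exact: Qs.
by apply: filterS => w H i; apply: H; rewrite mem_enum.
Qed.

Lemma measure_bigsetU_le {I : Type} (s : seq I) (F : I -> set T) :
  (forall i, measurable (F i)) ->
  (P (\big[setU/set0]_(i <- s) F i) <= \sum_(i <- s) P (F i))%E.
Proof.
move=> mF; elim: s => [|i s IH]; first by rewrite !big_nil measure0.
rewrite !big_cons; apply: le_trans (measureU2 _ _ _) _ => //.
  by apply: bigsetU_measurable.
by rewrite leeD2l.
Qed.

Lemma measurable_superlevel (f : T -> R) (s : R) : measurable_fun setT f ->
  measurable [set w | s <= f w].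
Proof.
move=> mf; rewrite -[X in measurable X]setTI.
rewrite (_ : [set w | _] = f @^-1` `[s, +oo[); first exact: mf.
by apply/seteqP; split => w /=; rewrite in_itv/= andbT.
Qed.

Lemma measurable_sublevel (f : T -> R) (s : R) : measurable_fun setT f ->
  measurable [set w | f w <= s].
Proof.
move=> mf; rewrite -[X in measurable X]setTI.
rewrite (_ : [set w | _] = f @^-1` `]-oo, s]); first exact: mf.
by apply/seteqP; split => w /=; rewrite in_itv.
Qed.

(** Clamping replaces a variable that lies in [a, b] almost surely by a version that lies there
    everywhere. *)
Definition clamp (a b x : R) := Num.min b (Num.max a x).

Lemma clamp_bounds (a b x : R) : a <= b -> a <= clamp a b x <= b.
Proof. by move=> ab; rewrite /clamp le_min ab le_max lexx ge_min lexx. Qed.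

Lemma clamp_id (a b x : R) : a <= x <= b -> clamp a b x = x.
Proof. by move=> /andP[ax xb]; rewrite /clamp (max_idPr ax) (min_idPr xb). Qed.

Lemma measurable_clamp (a b : R) : measurable_fun setT (clamp a b).
Proof. by apply: measurable_minr => //; exact: measurable_maxr. Qed.

Lemma measurable_clamp_RV (a b : R) (X : {RV P >-> R}) :
  measurable_fun setT (clamp a b \o X).
Proof. by apply: measurableT_comp => //; exact: measurable_clamp. Qed.

Definition clamp_RV (a b : R) (X : {RV P >-> R}) : {RV P >-> R} :=
  mkRV P (measurable_clamp_RV a b X).

Lemma expectation_clamp (a b : R) (X : {RV P >-> R}) :
  {ae P, forall w, a <= X w <= b} -> ('E_P[clamp_RV a b X] = 'E_P[X])%E.
Proof.
move=> Xab; rewrite unlock; apply: ae_eq_integral => //.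
- exact/measurable_EFinP.
- exact/measurable_EFinP.
- by apply: filterS Xab => w h _ /=; congr EFin; exact: clamp_id.
Qed.

Lemma ae_expectation_bounds (a b : R) (X : {RV P >-> R}) : a <= b ->
  {ae P, forall w, a <= X w <= b} -> a <= fine ('E_P[X])%E <= b.
Proof.
move=> ab Xab; rewrite -(expectation_clamp Xab); apply: expectation_bounds => w.
exact: clamp_bounds.
Qed.

(** Clamping preserves independence, since it is measurable, and expectations, since it changes each
    variable on a null set only. The absolute value is covered by the weights [q] and their
    negatives. *)
Lemma hoeffding {I : finType} (X : I -> {RV P >-> R}) (q : I -> R)
    (a b V s : R) : mutually_independent P X -> a <= b ->
  (forall i, {ae P, forall w, a <= X i w <= b}) ->
  (b - a) ^+ 2 * \sum_i q i ^+ 2 <= V -> 0 < V -> 0 < s ->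
  (P [set w | (s <= `|\sum_i q i * (X i w - fine 'E_P[X i]%E)|)%R]
    <= (2 * expR (- (s ^+ 2 / (8 * V))))%:E)%E.
Proof.
move=> indep ab Xab qV V0 s0.
have mX i : measurable_fun setT (X i) by exact: measurable_funP.
pose X' i := clamp_RV a b (X i).
have indep' : mutually_independent P X'.
  move=> E mE.
  apply: (indep (fun i => clamp a b @^-1` E i)) => i.
  by rewrite -[X in measurable X]setTI; exact: measurable_clamp.
have X'ab i w : a <= X' i w <= b by exact: clamp_bounds.
have aeX : {ae P, forall w, forall i, X' i w = X i w}.
  apply: ae_forall_fin => i; apply: filterS (Xab i) => w; exact: clamp_id.
have EX i : ('E_P[X' i] = 'E_P[X i])%E by exact: expectation_clamp.
have V8 := fun q' => @hoeffding_bounded R d T P I X' q' a b V s indep' X'ab.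
pose S (q' : I -> R) w := \sum_i q' i * (X' i w - fine ('E_P[X' i])%E).
have mS q' : measurable_fun setT (S q').
  apply: measurable_sum => i.
  by apply: measurable_funM => //; apply: measurable_funB => //; exact: measurable_clamp_RV.
have mSX : measurable_fun setT (fun w => `|\sum_i q i * (X i w - fine ('E_P[X i])%E)|).
  apply: measurableT_comp => //; apply: measurable_sum => i.
  by apply: measurable_funM => //; exact: measurable_funB.
apply: (@le_trans _ _ (P ([set w | s <= S q w] `|` [set w | s <= S (\- q) w]))).
  apply: ae_le_measure.
  - exact: measurable_superlevel.
  - by apply: measurableU; exact: measurable_superlevel.
  apply: filterS aeX => w h /=.
  have -> : S q w = \sum_i q i * (X i w - fine ('E_P[X i])%E).
    by apply: eq_bigr => i _; congr (_ * (_ - fine _)); [exact: h|exact: EX].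
  have -> : S (\- q) w = - \sum_i q i * (X i w - fine ('E_P[X i])%E).
    rewrite -sumrN; apply: eq_bigr => i _ /=; rewrite mulNr.
    by congr (- (_ * (_ - fine _))); [exact: h|exact: EX].
  by rewrite real_ler_normr ?num_real// => /orP.
apply: le_trans (measureU2 _ _ _) _; [exact: measurable_superlevel..|].
rewrite mulr_natl mulr2n EFinD leeD// V8//.
by under eq_bigr do rewrite sqrrN.
Qed.

(** * Measurability of Sinkhorn's iterates and existence of a random scaling *)

Lemma measurable_fun_invr (f : T -> R) : measurable_fun setT f ->
  (forall w, 0 < f w) -> measurable_fun setT (fun w => (f w)^-1).
Proof.
move=> mf f0.
rewrite (_ : (fun w => _) = (@powR R ^~ (-1)) \o f).
  by apply: measurableT_comp => //; exact: measurable_powR.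
by apply/funext => w /=; rewrite powR_inv1// ltW.
Qed.

Lemma measurable_half_step {I J : finType} (i0 : I) (A : I -> J -> T -> R) c
    (u : I -> T -> R) j :
  (forall i j, measurable_fun setT (A i j)) ->
  (forall i, measurable_fun setT (u i)) ->
  (forall i j w, 0 < A i j w) -> (forall i w, 0 < u i w) ->
  measurable_fun setT
    (fun w => half_step (fun i j => A i j w) c (fun i => u i w) j).
Proof.
move=> mA mu A0 u0; apply: measurable_funM => //.
apply: measurable_fun_invr.
  by apply: measurable_sum => i; exact: measurable_funM.
by move=> w; apply: (sum_gt0 i0) => i; exact: mulr_gt0.
Qed.

Lemma measurable_sinkhorn {I J : finType} (i0 : I) (j0 : J) (r : I -> R)
    (c : J -> R) (A : I -> J -> T -> R) n i :
  (forall i, 0 < r i) -> (forall j, 0 < c j) ->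
  (forall i j, measurable_fun setT (A i j)) ->
  (forall i j w, 0 < A i j w) ->
  measurable_fun setT (fun w => sinkhorn r c (fun i j => A i j w) n i).
Proof.
move=> r0 c0 mA A0; elim: n i => [|n IH] i; first exact: measurable_cst.
rewrite /sinkhorn; under eq_fun do rewrite iterS -/(sinkhorn _ _ _ _).
have s0 k w : 0 < sinkhorn r c (fun i j => A i j w) n k by exact: sinkhorn_gt0.
apply: (@measurable_half_step J I j0 (fun j i => A i j) r
  (fun j w => half_step (fun i j => A i j w) c (sinkhorn r c (fun i j => A i j w) n) j)) => //.
  by move=> j; exact: (@measurable_half_step I J i0 A c
    (fun i w => sinkhorn r c (fun i j => A i j w) n i)).
by move=> j w; exact: (half_step_gt0 i0).
Qed.

(** The scaling is a pointwise limit of measurable iterates, hence measurable. Multiplying one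
    factor by [k] and the other by its inverse keeps the scaling equations and prescribes the
    coordinate at [i0], as the stability estimate requires. *)
Lemma random_scaling_exists {m n : nat} (i0 : 'I_m) (j0 : 'I_n)
    (At : 'I_m -> 'I_n -> {RV P >-> R}) (r : 'rV[R]_m) (c : 'rV[R]_n) (k : R) :
  0 < k -> positive_mx r -> positive_mx c -> norm1 r = norm1 c ->
  (forall w, positive_mx (mx_of At w)) ->
  exists (xt : 'I_m -> {RV P >-> R}) (yt : 'I_n -> {RV P >-> R}),
    (forall w, [/\ positive_mx (rv_of xt w), positive_mx (rv_of yt w) &
      scales (rv_of xt w) (rv_of yt w) (mx_of At w) r c]) /\
    (forall w, xt i0 w = k).
Proof.
move=> k0 r0 c0 rc At0.
have A0 i j w : 0 < At i j w by have := At0 w i j; rewrite mxE.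
have r0' i : 0 < r 0 i by exact: r0.
have c0' j : 0 < c 0 j by exact: c0.
have rc' : \sum_i r 0 i = \sum_j c 0 j.
  move: rc; rewrite /norm1.
  under eq_bigr do rewrite gtr0_norm//.
  by under [RHS]eq_bigr do rewrite gtr0_norm//.
have mA i j : measurable_fun setT (At i j) by exact: measurable_funP.
have /choice[u Hu] w := sinkhorn_normalized_cvg i0 j0 r0' c0' (fun i j => A0 i j w).
have u0 i w : 0 < u w i by case: (Hu w).
have u1 w : u w i0 = 1 by case: (Hu w).
have ucv i w : sinkhorn_normalized i0 (r 0) (c 0) (fun i j => At i j w) ^~ i @ \oo
    --> u w i by case: (Hu w).
have mu i : measurable_fun setT (fun w => u w i).
  apply: (@measurable_fun_cvg _ _ _ setT (fun l w =>
    sinkhorn_normalized i0 (r 0) (c 0) (fun i j => At i j w) l i)).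
    move=> l; apply: measurable_funM; first exact: (measurable_sinkhorn i0 j0).
    apply: measurable_fun_invr; first exact: (measurable_sinkhorn i0 j0).
    by move=> w; exact: sinkhorn_gt0.
  by move=> w _; exact: ucv.
have mxt i : measurable_fun setT (fun w => k * u w i) by exact: measurable_funM.
pose v w := half_step (fun i j => At i j w) (c 0) (u w).
have myt j : measurable_fun setT (fun w => k^-1 * v w j).
  apply: measurable_funM => //.
  exact: (@measurable_half_step _ _ i0 (fun i j => At i j) (c 0) (fun i w => u w i)).
have v0 w j : 0 < v w j by exact: (half_step_gt0 i0).
exists (fun i => mkRV P (mxt i)), (fun j => mkRV P (myt j)); split; last first.
  by move=> w /=; rewrite u1 mulr1.
move=> w; have [hr hc] := sinkhorn_limit_scales j0 r0' c0' rc'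
  (fun i j => A0 i j w) (fun i => u0 i w) (u1 w) (fun i => ucv i w).
split.
- by move=> i j; rewrite mxE/= mulr_gt0.
- by move=> i j; rewrite mxE/= mulr_gt0 ?invr_gt0.
split=> [i|j].
- rewrite -hr mulr_sumr; apply: eq_bigr => j _; rewrite !mxE/= -/(v w).
  by field; rewrite gt_eqF.
- rewrite -hc mulr_sumr; apply: eq_bigr => i _; rewrite !mxE/= -/(v w).
  by field; rewrite gt_eqF.
Qed.

End AlmostSure.

(** * Concentration of the scaling *)

Section Concentration.
Context {R : realType}.

(** With X and Y the sums of [x] and [y]: a x_i Y <= r_i, a y_j X <= c_j, and the total mass is at
    most b X Y. Multiplying these eliminates X and Y. *)
Lemma scaling_weight_le {I J : finType} (i0 : I) (j0 : J) (A : I -> J -> R)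
    (r x : I -> R) (c y : J -> R) (a b : R) i j :
  0 < a -> (forall i j, a <= A i j <= b) ->
  (forall i, 0 < r i) -> (forall i, 0 < x i) -> (forall j, 0 < y j) ->
  (forall i, x i * \sum_j A i j * y j = r i) ->
  (forall j, y j * \sum_i A i j * x i = c j) ->
  x i * y j / r i <= b / a ^+ 2 * (c j / \sum_i r i).
Proof.
move=> a0 Aab r0 x0 y0 hr hc.
have X0 : 0 < \sum_i x i by exact: sum_gt0.
have Y0 : 0 < \sum_j y j by exact: sum_gt0.
have S0 : 0 < \sum_i r i by exact: sum_gt0.
have b0 : 0 < b.
  by apply: (lt_le_trans a0); case/andP: (Aab i0 j0) => v w; exact: le_trans v w.
have h1 : x i * (a * \sum_j y j) <= r i.
  rewrite -hr ler_wpM2l ?(ltW (x0 _))//.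
  by case/andP: (weighted_sum_bounds (fun j => Aab i j) y0).
have h2 : y j * (a * \sum_i x i) <= c j.
  rewrite -hc ler_wpM2l ?(ltW (y0 _))//.
  by case/andP: (weighted_sum_bounds (fun i => Aab i j) x0).
have h3 : \sum_i r i <= b * (\sum_i x i) * \sum_j y j.
  rewrite mulrAC mulr_sumr; apply: ler_sum => k _.
  rewrite -hr mulrC ler_wpM2r ?(ltW (x0 _))//.
  by case/andP: (weighted_sum_bounds (fun j => Aab k j) y0).
move: X0 Y0 S0 h1 h2 h3.
set X := \sum_i x i; set Y := \sum_j y j; set S := \sum_i r i.
move=> X0 Y0 S0 h1 h2 h3.
rewrite ler_pdivrMr//.
have -> : b / a ^+ 2 * (c j / S) * r i = b * (r i * c j) / (a ^+ 2 * S).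
  by field; rewrite !gt_eqF.
rewrite ler_pdivlMr ?mulr_gt0 ?exprn_gt0//.
apply: (@le_trans _ _ (x i * y j * (a ^+ 2 * (b * X * Y)))).
  rewrite ler_wpM2l ?mulr_ge0 ?(ltW (x0 _)) ?(ltW (y0 _))//.
  by rewrite ler_wpM2l// exprn_ge0// ltW.
have -> : x i * y j * (a ^+ 2 * (b * X * Y)) =
    b * ((x i * (a * Y)) * (y j * (a * X))) by ring.
rewrite ler_wpM2l ?(ltW b0)//; apply: ler_pM => //.
- by rewrite mulr_ge0 ?mulr_ge0 ?(ltW (x0 _)) ?(ltW a0) ?(ltW Y0).
- by rewrite mulr_ge0 ?mulr_ge0 ?(ltW (y0 _)) ?(ltW a0) ?(ltW X0).
Qed.

Lemma norm1_gt0E {n : nat} (v : 'rV[R]_n) : positive_mx v ->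
  norm1 v = \sum_i v 0 i.
Proof. by move=> v0; apply: eq_bigr => i _; rewrite gtr0_norm. Qed.

Lemma norm1_min_entry {n : nat} (i0 : 'I_n) (v : 'rV[R]_n) : positive_mx v ->
  1 <= norm1 v / (n%:R * min_entry v).
Proof.
move=> v0; have [k hk] := finfun_min_attained i0 (v 0).
have -> : min_entry v = v 0 k.
  rewrite /min_entry; apply/eqP; rewrite eq_le; apply/andP; split.
    by apply: ge_inf; [exists (v 0 k) => _ [i _ <-]; exact: hk|exists k].
  by apply: lb_le_inf; [exists (v 0 k); exists k|move=> _ [i _ <-]; exact: hk].
have n0 : (0 < n)%N by case: n i0 {v v0 k hk} => // -[].
have vk0 : 0 < v 0 k by exact: v0.
rewrite ler_pdivlMr ?mulr_gt0 ?ltr0n//.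
rewrite mul1r norm1_gt0E// mulr_natl -[n in _ *+ n]card_ord -sumr_const.
by apply: ler_sum => i _; exact: hk.
Qed.

Lemma rho2_ge1 {m n : nat} (i0 : 'I_m) (r : 'rV[R]_m) (c : 'rV[R]_n) :
  positive_mx r -> 1 <= rho2 r c.
Proof. by move=> r0; rewrite /rho2 le_max (norm1_min_entry i0). Qed.

Lemma rho1_gt0 {m n : nat} (i0 : 'I_m) (r : 'rV[R]_m) (c : 'rV[R]_n) :
  positive_mx r -> 0 < rho1 r c.
Proof.
move=> r0; rewrite /rho1 lt_max; apply/orP; left.
have r0' i : 0 < r 0 i by exact: r0.
rewrite divr_gt0//.
  by rewrite sqrtr_gt0; apply: (sum_gt0 i0) => i; rewrite exprn_gt0.
by rewrite norm1_gt0E//; exact: (sum_gt0 i0).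
Qed.

(** The weights of a row error are controlled by c_j / s and those of a column error by r_i / s, so
    these sums bound both Hoeffding variances. *)
Lemma sum_sqr_le_rho1 {m n : nat} (r : 'rV[R]_m) (c : 'rV[R]_n) :
  (\sum_i (r 0 i / norm1 r) ^+ 2 <= rho1 r c ^+ 2) /\
  (\sum_j (c 0 j / norm1 r) ^+ 2 <= rho1 r c ^+ 2).
Proof.
have s0 : 0 <= norm1 r by apply: sumr_ge0 => i _.
have h k (v : 'rV[R]_k) : norm2 v / norm1 r <= rho1 r c ->
    \sum_i (v 0 i / norm1 r) ^+ 2 <= rho1 r c ^+ 2.
  move=> hv; under eq_bigr do rewrite exprMn.
  rewrite -mulr_suml -[X in X * _]sqr_sqrtr; last first.
    by apply: sumr_ge0 => i _; exact: sqr_ge0.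
  have n0 : 0 <= norm2 v / norm1 r by rewrite divr_ge0// sqrtr_ge0.
  by rewrite -exprMn lerXn2r// nnegrE//; exact: le_trans hv.
by split; apply: h; rewrite /rho1 le_max lexx ?orbT.
Qed.

Context {d : measure_display} {T : measurableType d} (P : probability T R).

Lemma weighted_deviation_tail {I : finType} (X : I -> {RV P >-> R})
    (q v : I -> R) (a b rho : R) (k : nat) :
  mutually_independent P X -> 0 < a -> a <= b ->
  (forall i, {ae P, forall w, a <= X i w <= b}) ->
  (forall i, 0 <= q i <= b / a ^+ 2 * v i) -> \sum_i v i ^+ 2 <= rho ^+ 2 ->
  0 < rho -> (1 < k)%N ->
  (P [set w | (4 * (b / a) ^+ 2 * rho * Num.sqrt (ln k%:R) <=
        `|\sum_i q i * (X i w - fine 'E_P[X i]%E)|)%R]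
    <= (2 / k%:R ^+ 2)%:E)%E.
Proof.
move=> indep a0 ab Xab qv vr rho0 k1.
have b0 : 0 < b by exact: lt_le_trans ab.
have k0 : 0 < k%:R :> R by rewrite ltr0n ltnW.
have lnk : 0 < ln k%:R :> R by rewrite ln_gt0// ltr1n.
(* Obtained from b - a <= b and q_i <= (b / a^2) v_i. With the factor 4 in the threshold the
   Hoeffding exponent is exactly 2 ln k. *)
pose V := ((b / a) ^+ 2 * rho) ^+ 2.
have V0 : 0 < V by rewrite /V exprn_gt0// mulr_gt0// exprn_gt0// divr_gt0.
have qV : (b - a) ^+ 2 * \sum_i q i ^+ 2 <= V.
  have -> : V = b ^+ 2 * ((b / a ^+ 2) ^+ 2 * rho ^+ 2).
    by rewrite /V; field; rewrite gt_eqF.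
  apply: ler_pM; [exact: sqr_ge0|by apply: sumr_ge0 => i _; exact: sqr_ge0| |].
    by rewrite lerXn2r ?nnegrE ?subr_ge0 ?(ltW b0)// gerBl ltW.
  apply: (@le_trans _ _ ((b / a ^+ 2) ^+ 2 * \sum_i v i ^+ 2)).
    rewrite mulr_sumr; apply: ler_sum => i _; rewrite -exprMn.
    by case/andP: (qv i) => h1 h2; rewrite lerXn2r ?nnegrE//; exact: le_trans h2.
  by rewrite ler_wpM2l// sqr_ge0.
have s0 : 0 < 4 * (b / a) ^+ 2 * rho * Num.sqrt (ln k%:R).
  by rewrite mulr_gt0 ?sqrtr_gt0// !mulr_gt0// ?invr_gt0.
apply: le_trans (hoeffding indep ab Xab qV V0 s0) _.
rewrite lee_fin ler_wpM2l// /V.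
set K := (b / a) ^+ 2; have K0 : 0 < K by rewrite exprn_gt0// divr_gt0.
have -> : (4 * K * rho * Num.sqrt (ln k%:R)) ^+ 2 / (8 * (K * rho) ^+ 2) = 2 * ln k%:R.
  rewrite exprMn sqr_sqrtr ?(ltW lnk)//.
  by field; rewrite !gt_eqF.
by rewrite expRN expRM_natl lnK ?posrE//.
Qed.

(** Outside at most 2k events of probability at most 2 / k^2 each, and a null set, all relative row
    and column errors are below eps and the stability estimate applies. *)
Lemma scaling_concentration {m n : nat} (i0 : 'I_m) (j0 : 'I_n)
    (At : 'I_m -> 'I_n -> {RV P >-> R}) (xt : 'I_m -> {RV P >-> R})
    (yt : 'I_n -> {RV P >-> R}) (r x : 'rV[R]_m) (c y : 'rV[R]_n) (a b : R)
    (k : nat) :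
  0 < a -> a <= b -> positive_mx r -> positive_mx c -> norm1 r = norm1 c ->
  positive_mx x -> positive_mx y -> scales x y (expectation_mx At) r c ->
  (forall i j, {ae P, forall w, a <= At i j w <= b}) ->
  (forall i, mutually_independent P (fun j => At i j)) ->
  (forall j, mutually_independent P (fun i => At i j)) ->
  (forall w, [/\ positive_mx (rv_of xt w), positive_mx (rv_of yt w) &
      scales (rv_of xt w) (rv_of yt w) (mx_of At w) r c]) ->
  (forall w, xt i0 w = x 0 i0) -> (m <= k)%N -> (n <= k)%N -> (1 < k)%N ->
  ((1 - 4 / k%:R)%:E <= P [set w | (random_error xt yt x y w <=
     12 * (b / a) ^+ 7 * (rho1 r c * rho2 r c * Num.sqrt (ln k%:R)))%R])%E.
Proof.
move=> a0 ab r0 c0 rc x0 y0 [xyr xyc] Aab Arow Acol xyt xtn mk nk k1.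
have b0 : 0 < b by exact: lt_le_trans ab.
have r0' i : 0 < r 0 i by exact: r0.
have c0' j : 0 < c 0 j by exact: c0.
have x0' i : 0 < x 0 i by exact: x0.
have y0' j : 0 < y 0 j by exact: y0.
pose A i j := fine ('E_P[At i j])%E.
have A_ab i j : a <= A i j <= b by exact: ae_expectation_bounds.
have hr i : x 0 i * \sum_j A i j * y 0 j = r 0 i.
  rewrite -xyr mulr_sumr; apply: eq_bigr => j _; by rewrite mxE mulrA.
have hc j : y 0 j * \sum_i A i j * x 0 i = c 0 j.
  rewrite -xyc mulr_sumr; apply: eq_bigr => i _; by rewrite mxE /A; ring.
have k0 : 0 < k%:R :> R by rewrite ltr0n ltnW.
set rho := rho1 r c.
have rho0 : 0 < rho by exact: (rho1_gt0 i0).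
pose eps := 4 * (b / a) ^+ 2 * rho * Num.sqrt (ln k%:R).
have eps0 : 0 <= eps.
  by rewrite /eps mulr_ge0 ?sqrtr_ge0// ltW// !mulr_gt0// ?invr_gt0.
(* Relative errors of the row and column sums of [At] scaled by the deterministic pair; they are
   centered because that pair scales the expectation exactly. *)
pose Dr i w := \sum_j (x 0 i * y 0 j / r 0 i) * (At i j w - A i j).
pose Dc j w := \sum_i (y 0 j * x 0 i / c 0 j) * (At i j w - A i j).
have [sqr_r sqr_c] := sum_sqr_le_rho1 r c.
have tail_r i : (P [set w | (eps <= `|Dr i w|)%R] <= (2 / k%:R ^+ 2)%:E)%E.
  apply: (@weighted_deviation_tail _ _ _ (fun j => c 0 j / norm1 r)) => //.
  move=> j; rewrite divr_ge0 ?mulr_ge0 ?(ltW (x0' _)) ?(ltW (y0' _)) ?(ltW (r0' _))//=.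
  rewrite norm1_gt0E//.
  exact: (scaling_weight_le i0 j0 i j a0 A_ab r0' x0' y0' hr hc).
have tail_c j : (P [set w | (eps <= `|Dc j w|)%R] <= (2 / k%:R ^+ 2)%:E)%E.
  apply: (@weighted_deviation_tail _ _ _ (fun i => r 0 i / norm1 r)) => //.
  move=> i; rewrite divr_ge0 ?mulr_ge0 ?(ltW (x0' _)) ?(ltW (y0' _)) ?(ltW (c0' _))//=.
  rewrite rc norm1_gt0E//.
  exact: (scaling_weight_le j0 i0 j i a0 (fun j i => A_ab i j) c0' y0' x0' hc hr).
have mA i j : measurable_fun setT (At i j) by exact: measurable_funP.
have mDr i : measurable_fun setT (fun w => `|Dr i w|).
  apply: measurableT_comp => //; apply: measurable_sum => j.
  by apply: measurable_funM => //; exact: measurable_funB.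
have mDc j : measurable_fun setT (fun w => `|Dc j w|).
  apply: measurableT_comp => //; apply: measurable_sum => i.
  by apply: measurable_funM => //; exact: measurable_funB.
pose Br i := [set w | eps <= `|Dr i w|].
pose Bc j := [set w | eps <= `|Dc j w|].
have mBr i : measurable (Br i) by exact: measurable_superlevel.
have mBc j : measurable (Bc j) by exact: measurable_superlevel.
set gam := 12 * _ * _.
pose G := [set w | random_error xt yt x y w <= gam].
have mG : measurable G.
  by apply: measurable_sublevel; exact: measurable_random_error.
(* The constant is 3 (b / a)^5 from stability times 4 (b / a)^2 from eps; [rho2] enters through 1 <=
   rho2. *)
have eps_gam : 3 * (b / a) ^+ 5 * eps <= gam.
  have -> : 3 * (b / a) ^+ 5 * eps = 12 * (b / a) ^+ 7 * (rho * 1 * Num.sqrt (ln k%:R)).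
    by rewrite /eps; ring.
  apply: ler_wpM2l; first by rewrite mulr_ge0// exprn_ge0// divr_ge0// ltW.
  by rewrite ler_wpM2r ?sqrtr_ge0// ler_wpM2l ?(ltW rho0)// (rho2_ge1 i0).
(* The inclusion holds only almost surely, since the entries lie in [a, b] only almost surely. *)
have good : {ae P, forall w, (~` G) w ->
    ((\big[setU/set0]_i Br i) `|` (\big[setU/set0]_j Bc j)) w}.
  have Aae : {ae P, forall w, forall i j, a <= At i j w <= b}.
    by apply: ae_forall_fin => i; exact: ae_forall_fin.
  apply: filterS Aae => w hw nG; apply: contrapT => nB; apply: nG.
  have Dr_lt i : `|Dr i w| < eps.
    rewrite ltNge; apply/negP => h; apply: nB; left.
    by rewrite (bigD1 i)//=; left.
  have Dc_lt j : `|Dc j w| < eps.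
    rewrite ltNge; apply/negP => h; apply: nB; right.
    by rewrite (bigD1 j)//=; left.
  have [xt0 yt0 [xytr xytc]] := xyt w.
  have xt0' i : 0 < xt i w by have := xt0 0 i; rewrite mxE.
  have yt0' j : 0 < yt j w by have := yt0 0 j; rewrite mxE.
  have DrE i : Dr i w * r 0 i = x 0 i * (\sum_j At i j w * y 0 j) - r 0 i.
    rewrite -[in RHS]hr -mulrBr -sumrB mulr_suml mulr_sumr.
    by apply: eq_bigr => j _; field; rewrite gt_eqF.
  have DcE j : Dc j w * c 0 j = y 0 j * (\sum_i At i j w * x 0 i) - c 0 j.
    rewrite -[in RHS]hc -mulrBr -sumrB mulr_suml mulr_sumr.
    by apply: eq_bigr => i _; field; rewrite gt_eqF.
  have hrt i : xt i w * \sum_j At i j w * yt j w = r 0 i.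
    by rewrite -xytr mulr_sumr; apply: eq_bigr => j _; rewrite !mxE mulrA.
  have hct j : yt j w * \sum_i At i j w * xt i w = c 0 j.
    by rewrite -xytc mulr_sumr; apply: eq_bigr => i _; rewrite !mxE; ring.
  have er i : `|x 0 i * (\sum_j At i j w * y 0 j) - r 0 i| <= eps * r 0 i.
    by rewrite -DrE normrM (gtr0_norm (r0' i)) ler_wpM2r ?(ltW (r0' _)) ?(ltW (Dr_lt _)).
  have ec j : `|y 0 j * (\sum_i At i j w * x 0 i) - c 0 j| <= eps * c 0 j.
    by rewrite -DcE normrM (gtr0_norm (c0' j)) ler_wpM2r ?(ltW (c0' _)) ?(ltW (Dc_lt _)).
  have [hx hy] := @scaling_stability R _ _ i0 j0 (fun i j => At i j w) A
    (r 0) (fun i => xt i w) (x 0) (c 0) (fun j => yt j w) (y 0) a b eps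
    a0 ab eps0 hw A_ab r0' c0' xt0' x0' yt0' y0' hrt hct hr hc er ec (xtn w).
  have gam0 : 0 <= gam.
    by apply: le_trans eps_gam; rewrite mulr_ge0// mulr_ge0// exprn_ge0// divr_ge0// ltW.
  rewrite /G /random_error /scaling_error /max_rel_dev /= ge_max.
  apply/andP; split; apply: bigmax_le => // i _; rewrite mxE ler_pdivrMr//.
    by apply: le_trans (hx i) _; rewrite ler_wpM2r// ltW.
  by apply: le_trans (hy i) _; rewrite ler_wpM2r// ltW.
have mU : measurable ((\big[setU/set0]_i Br i) `|` (\big[setU/set0]_j Bc j)).
  by apply: measurableU; apply: bigsetU_measurable.
have PC : (P (~` G) <= (4 / k%:R)%:E)%E.
  apply: le_trans (ae_le_measure (measurableC mG) mU good) _.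
  apply: le_trans (measureU2 _ _ _) _; [exact: bigsetU_measurable..|].
  have tl l (B : 'I_l -> set T) : (forall i, measurable (B i)) -> (l <= k)%N ->
      (forall i, P (B i) <= (2 / k%:R ^+ 2)%:E)%E ->
      (P (\big[setU/set0]_i B i) <= (2 / k%:R)%:E)%E.
    move=> mB lk hB; apply: le_trans (measure_bigsetU_le _ _ mB) _.
    apply: (@le_trans _ _ (\sum_(i < l) (2 / k%:R ^+ 2)%:E)%E).
      by apply: lee_sum => i _; exact: hB.
    rewrite sumEFin lee_fin sumr_const card_ord -[leLHS]mulr_natl.
    rewrite (_ : 2 / k%:R = k%:R * (2 / k%:R ^+ 2)); last by field; rewrite gt_eqF.
    by rewrite ler_wpM2r ?ler_nat// divr_ge0// exprn_ge0// ltW.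
  rewrite (_ : 4 / k%:R = 2 / k%:R + 2 / k%:R); last by field; rewrite gt_eqF.
  by rewrite EFinD leeD// tl.
have -> : P [set w | (random_error xt yt x y w <= gam)%R] = (1 - P (~` G))%E.
  by rewrite -probability_setC ?setCK//; exact: measurableC.
by rewrite EFinB leeB.
Qed.

End Concentration.

(** * Choice of a random scaling for every N and passage to the limit *)

Theorem theorem4 (R : realType)
    (d : nat -> measure_display) (T : forall N, measurableType (d N))
    (P : forall N, probability (T N) R)
    (N0 : nat) (M : nat -> nat)
    (r : forall N, 'rV[R]_(M N)) (c : forall N, 'rV[R]_N)
    (At : forall N, 'I_(M N) -> 'I_N -> {RV (P N) >-> R})
    (x : forall N, 'rV[R]_(M N)) (y : forall N, 'rV[R]_N)
    (a b : R)
    (N0_gt0 : (0 < N0)%N)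
    (M_gt0 : forall N, (N0 <= N)%N -> (0 < M N)%N)
    (M_infty : M @ \oo --> \oo)
    (r_gt0 : forall N, (N0 <= N)%N -> positive_mx (r N))
    (c_gt0 : forall N, (N0 <= N)%N -> positive_mx (c N))
    (rc_norm1 : forall N, (N0 <= N)%N -> norm1 (r N) = norm1 (c N))
    (At_gt0 : forall N, (N0 <= N)%N ->
      forall w, positive_mx (mx_of (@At N) w))
    (x_gt0 : forall N, (N0 <= N)%N -> positive_mx (x N))
    (y_gt0 : forall N, (N0 <= N)%N -> positive_mx (y N))
    (xy_norm1 : forall N, (N0 <= N)%N -> norm1 (x N) = norm1 (y N))
    (xy_scales : forall N, (N0 <= N)%N ->
      scales (x N) (y N) (expectation_mx (@At N)) (r N) (c N))
    (a_gt0 : 0 < a) (a_le_b : a <= b)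
    (At_bounded : forall N, (N0 <= N)%N -> forall i j,
      {ae P N, forall w, a <= @At N i j w <= b})
    (At_row_indep : forall N, (N0 <= N)%N -> forall i,
      mutually_independent (P N) (fun j => @At N i j))
    (At_col_indep : forall N, (N0 <= N)%N -> forall j,
      mutually_independent (P N) (fun i => @At N i j)) :
  exists (xt : forall N, 'I_(M N) -> {RV (P N) >-> R})
         (yt : forall N, 'I_N -> {RV (P N) >-> R}),
    (forall N, (N0 <= N)%N -> forall w,
      [/\ positive_mx (rv_of (xt N) w),
          positive_mx (rv_of (yt N) w) &
          scales (rv_of (xt N) w) (rv_of (yt N) w) (mx_of (@At N) w)
            (r N) (c N)]) /\
    bigO_whp P
      (fun N => random_error (xt N) (yt N) (x N) (y N))
      (fun N => rho1 (r N) (c N) * rho2 (r N) (c N) *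
                Num.sqrt (ln (maxn (M N) N)%:R)).
Proof.
pose good N (p : ('I_(M N) -> {RV (P N) >-> R}) * ('I_N -> {RV (P N) >-> R})) :=
  (N0 <= N)%N -> (forall w,
      [/\ positive_mx (rv_of p.1 w), positive_mx (rv_of p.2 w) &
          scales (rv_of p.1 w) (rv_of p.2 w) (mx_of (@At N) w) (r N) (c N)]) /\
    ((1 < N)%N -> ((1 - 4 / N%:R)%:E <= P N [set w |
      (random_error p.1 p.2 (x N) (y N) w <= 12 * (b / a) ^+ 7 *
        (rho1 (r N) (c N) * rho2 (r N) (c N) *
          Num.sqrt (ln (maxn (M N) N)%:R)))%R])%E).
have ex N : exists p, @good N p.
  have [hN|hN] := leqP N0 N; last first.
    (* Below [N0] nothing is required, and zero variables serve as placeholders. *)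
    exists ((fun=> (cst 0 : {RV P N >-> R})), (fun=> (cst 0 : {RV P N >-> R}))) => h.
    by move: hN; rewrite ltnNge h.
  pose i0 : 'I_(M N) := Ordinal (M_gt0 N hN).
  pose j0 : 'I_N := Ordinal (leq_trans N0_gt0 hN).
  have x00 : 0 < x N 0 i0 by exact: x_gt0.
  have [xt [yt [h1 h2]]] := random_scaling_exists i0 j0 x00 (r_gt0 N hN)
    (c_gt0 N hN) (rc_norm1 N hN) (At_gt0 N hN).
  exists (xt, yt) => _; split => //= N1.
  have k1 : (1 < maxn (M N) N)%N by rewrite (leq_trans N1)// leq_maxr.
  apply: le_trans (scaling_concentration j0 a_gt0 a_le_b (r_gt0 N hN)
    (c_gt0 N hN) (rc_norm1 N hN) (x_gt0 N hN) (y_gt0 N hN) (xy_scales N hN)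
    (At_bounded N hN) (At_row_indep N hN) (At_col_indep N hN) h1 h2
    (leq_maxl _ _) (leq_maxr _ _) k1).
  (* The failure probability 4 / max(M, N) is at most 4 / N. *)
  rewrite lee_fin lerB// ler_wpM2l// lef_pV2 ?posrE ?ltr0n ?ler_nat ?leq_maxr//.
    exact: ltnW.
  exact: ltnW.
pose p N := sval (cid (ex N)).
have pP N : @good N (p N) by exact: (svalP (cid (ex N))).
exists (fun N => (p N).1), (fun N => (p N).2); split.
  by move=> N hN; case: (pP N hN).
exists (12 * (b / a) ^+ 7).
(* [harmonic N] is 1 / (N + 1), and 4 / N <= 8 / (N + 1) for N >= 1. *)
apply: (@squeeze_cvge _ _ _ _ (fun N => (1 - 8 * harmonic N)%:E) _ (fun=> 1%E)).
- near=> N; apply/andP; split; last first.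
    by apply/probability_le1/measurable_sublevel; exact: measurable_random_error.
  have hN : (N0 <= N)%N by near: N; exact: nbhs_infty_ge.
  have N1 : (1 < N)%N by near: N; exact: nbhs_infty_gt.
  case: (pP N hN) => _ /(_ N1); apply: le_trans.
  rewrite lee_fin lerB// /harmonic /=.
  have N0' : 0 < N%:R :> R by rewrite ltr0n ltnW.
  rewrite ler_pdivrMr// mulrAC ler_pdivlMr ?ltr0n//.
  by rewrite -!natrM ler_nat; lia.
- apply: cvg_EFin; first by apply: nearW.
  rewrite -[X in _ --> X]subr0 -[X in _ - X](mulr0 8).
  apply: cvgB; first exact: cvg_cst.
  by apply: cvgM; [exact: cvg_cst|exact: cvg_harmonic].
- exact: cvg_cst.
Unshelve. all: by end_near.
Qed.
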